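(* Let $n\ge1$ and let $c,d$ be complex parameters. The two sequences (indexed by $n$-tuples $\boldsymbol k$ of nonnegative integers) \begin{align*} \alpha_{\boldsymbol k}(a,b)&:=\prod_{r=1}^n\frac{\theta(ax_rq^{k_r+|\boldsymbol k|};p)}{\theta(ax_r;p)}\frac{(ax_r;q,p)_{|\boldsymbol k|}(cx_r,\,dx_r;q,p)_{k_r}}{(bcdx_r/a;q,p)_{k_r}}\\ &\quad\times\frac{(a^2q/(bcd);q,p)_{|\boldsymbol k|}}{(aq/c,\,aq/d;q,p)_{|\boldsymbol k|}\prod_{r,s=1}^n(qx_r/x_s;q,p)_{k_r}}\left(\frac ba\right)^{|\boldsymbol k|}q^{\sum_{r<s}k_rk_s}\prod_{r=1}^nx_r^{-k_r} \end{align*} and $$\beta_{\boldsymbol k}(a,b):=\frac{(b,\,bc/a,\,bd/a;q,p)_{|\boldsymbol k|}}{(aq/c,\,aq/d;q,p)_{|\boldsymbol k|}\prod_{r,s=1}^n(qx_r/x_s;q,p)_{k_r}}\prod_{r=1}^n\frac{(aq^{1+|\boldsymbol k|-k_r}/(cdx_r);q,p)_{k_r}}{(bcdx_r/a;q,p)_{k_r}}$$ form a WP Bailey pair with respect to the matrix $\mathbf B^{(2)}$.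
   Context: Let $q,p$ be complex numbers with $q\neq 0$ and $|p|<1$. For $a\ne 0$ put $\theta(a;p)=\prod_{j\ge 0}(1-ap^j)(1-p^{j+1}/a)$. For an integer $k$ the $q,p$-shifted factorial is $(a;q,p)_k=\prod_{j=0}^{k-1}\theta(aq^j;p)$ if $k\ge 0$ (empty product $=1$), and $(a;q,p)_{k}=\big(\prod_{j=k}^{-1}\theta(aq^{j};p)\big)^{-1}$ if $k<0$. Write $(a_1,\dots,a_m;q,p)_k=(a_1;q,p)_k\cdots(a_m;q,p)_k$. For a tuple $\boldsymbol k=(k_1,\dots,k_n)$, $|\boldsymbol k|=k_1+\cdots+k_n$; $\sum_{r<s}$ is over $1\le r<s\le n$. The $x_1,\dots,x_n$ are fixed complex parameters. All parameters are nonzero and generic in the sense that no denominators vanish. WP Bailey pair: given a matrix $\mathbf B=(B_{\boldsymbol k\boldsymbol j}(a,b))$ indexed by $n$-tuples of nonnegative integers, sequences $\alpha_{\boldsymbol N}(a,b)$ and $\beta_{\boldsymbol N}(a,b)$ form a WP Bailey pair with respect to $\mathbf B$ if for all $n$-tuples $\boldsymbol N$ of nonnegative integers $$\beta_{\boldsymbol N}(a,b)=\sum_{0\le j_r\le N_r,\ r=1,\dots,n}B_{\boldsymbol N\boldsymbol j}(a,b)\,\alpha_{\boldsymbol j}(a,b).$$ The matrix $\mathbf B^{(2)}$ has entries $$B^{(2)}_{\boldsymbol k\boldsymbol j}(a,b)=\frac{(b;q,p)_{|\boldsymbol k|+|\boldsymbol j|}\prod_{r=1}^n(bq^{|\boldsymbol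 k|-k_r}/(ax_r);q,p)_{k_r-j_r}}{\prod_{r,s=1}^n(q^{1+j_r-j_s}x_r/x_s;q,p)_{k_r-j_r}\prod_{r=1}^n(ax_rq;q,p)_{k_r+|\boldsymbol j|}}.$$ *)

(* Defs.v *)
From mathcomp Require Import all_boot all_order all_algebra.
From mathcomp Require Import complex.
From mathcomp Require Import all_classical all_reals all_analysis.

Set Implicit Arguments.
Unset Strict Implicit.
Unset Printing Implicit Defensive.

Import Order.TTheory GRing.Theory Num.Theory.
Import numFieldNormedType.Exports.

Local Open Scope classical_set_scope.
Local Open Scope complex_scope.
Local Open Scope ring_scope.

(* [R[i]^o] carries the topology of the modulus; for [`|p| < 1] and [a != 0] the
   partial products converge, so that [lim] is then the infinite product. *)
Definition theta (R : realType) (p a : R[i]) : R[i] :=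
  lim ((fun m : nat =>
    \prod_(j < m) ((1 - a * p ^+ j) * (1 - p ^+ j.+1 / a)) : R[i]^o) @ \oo).

(* [Negz m] is the integer [- m.+1]; the index [j] here stands for [- j.+1]. *)
Definition qpfact (R : realType) (q p a : R[i]) (k : int) : R[i] :=
  match k with
  | Posz m => \prod_(j < m) theta p (a * q ^+ j)
  | Negz m => (\prod_(j < m.+1) theta p (a * q ^- j.+1))^-1
  end.

Definition qpfacts (R : realType) (q p : R[i]) (s : seq R[i]) (k : int) : R[i] :=
  \prod_(a <- s) qpfact q p a k.

Definition weight (n : nat) (k : 'I_n -> nat) : nat := (\sum_(r < n) k r)%N.

(* The sum over the dependent finite functions is the sum over all [n]-tuples [j]
   with [j r <= N r] for every [r]. *)
Definition WP_Bailey_pair (R : realType) (n : nat)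
    (B : R[i] -> R[i] -> ('I_n -> nat) -> ('I_n -> nat) -> R[i])
    (alpha beta : R[i] -> R[i] -> ('I_n -> nat) -> R[i]) (a b : R[i]) : Prop :=
  forall N : 'I_n -> nat,
    beta a b N =
    \sum_(j : {dffun forall r : 'I_n, 'I_(N r).+1})
      B a b N (fun r => j r : nat) * alpha a b (fun r => j r : nat).

Definition B2 (R : realType) (n : nat) (q p : R[i]) (x : 'I_n -> R[i])
    (a b : R[i]) (k j : 'I_n -> nat) : R[i] :=
  (qpfact q p b (weight k + weight j)%N
   * \prod_(r < n) qpfact q p (b * q ^ ((weight k)%:Z - (k r)%:Z) / (a * x r))
                     ((k r)%:Z - (j r)%:Z))
  / ((\prod_(r < n) \prod_(s < n)
        qpfact q p (q ^ (1 + (j r)%:Z - (j s)%:Z) * x r / x s)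
          ((k r)%:Z - (j r)%:Z))
     * \prod_(r < n) qpfact q p (a * x r * q) (k r + weight j)%N).

Definition alpha2 (R : realType) (n : nat) (q p : R[i]) (x : 'I_n -> R[i])
    (c d a b : R[i]) (k : 'I_n -> nat) : R[i] :=
  \prod_(r < n)
    (theta p (a * x r * q ^+ (k r + weight k)) / theta p (a * x r)
     * (qpfact q p (a * x r) (weight k)
        * qpfacts q p [:: c * x r; d * x r] (k r)
        / qpfact q p (b * c * d * x r / a) (k r)))
  * (qpfact q p (a ^+ 2 * q / (b * c * d)) (weight k)
     / (qpfacts q p [:: a * q / c; a * q / d] (weight k)
        * \prod_(r < n) \prod_(s < n) qpfact q p (q * x r / x s) (k r)))
  * (b / a) ^+ weight k
  * q ^+ (\sum_(r < n) \sum_(s < n | (r < s)%N) k r * k s)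
  * \prod_(r < n) x r ^- k r.

Definition beta2 (R : realType) (n : nat) (q p : R[i]) (x : 'I_n -> R[i])
    (c d a b : R[i]) (k : 'I_n -> nat) : R[i] :=
  qpfacts q p [:: b; b * c / a; b * d / a] (weight k)
  / (qpfacts q p [:: a * q / c; a * q / d] (weight k)
     * \prod_(r < n) \prod_(s < n) qpfact q p (q * x r / x s) (k r))
  * \prod_(r < n)
      (qpfact q p (a * q ^ (1 + (weight k)%:Z - (k r)%:Z) / (c * d * x r)) (k r)
       / qpfact q p (b * c * d * x r / a) (k r)).

(* Main.v *)
Require Import Defs.
From mathcomp Require Import all_boot all_order all_algebra.
From mathcomp Require Import ring zify.

(** The identity is an elliptic Jackson summation on the root system [A_n]. Its
    only analytic input is the three-term relation of theta: the function
    [E(x,y) = theta(xy) theta(x/y) / x] ([thpair]) satisfies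
    [E(x,y) E(u,v) - E(x,u) E(y,v) + E(x,v) E(y,u) = 0].

    Three-term relation. By the Jacobi triple product, [theta(xy) theta(x/y)] is
    a double series over [Z^2]. Splitting it according to the parity of the sum
    of the two indices shows that [E(x,y)] is a constant times a determinant
    [g1(x) g0(y) - g0(x) g1(y)], and determinants satisfy the Pluecker relation.
    The argument is run on the finite products defining theta, whose Laurent
    coefficients are Gauss binomials ([jacobi_expansion]), and the limit is taken
    by dominated convergence ([tannery], [theta_wedge_cvg], [theta_plucker]).

    Case where every [N_r] is 1. The sum is then over subsets [I] of a finite set
    [A] of points [x_r] ([subset_term], [subset_value]). Fix [t = cd]. As
    functions of [c], both sides are combinations of products of [#|A|] factors
    [theta(cu) theta(tu/c)]; by the three-term relation such products behave like
    homogeneous polynomials of degree [#|A|] in two variables, so they are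
    determined by their values at [#|A| + 1] nodes ([thpair_lagrange],
    [thsym_interp]). At the node [c = 1/x_m] the subsets containing [m] drop out
    and the identity becomes the one for [A] minus [m] with [c/q] in place of
    [c]; at [c = a q^#|A|] only [I = A] survives. Induction on [#|A|] gives the
    identity when the nodes are distinct modulo the symmetries
    ([subset_sum_generic]), and continuity of theta in [c] gives it always
    ([subset_sum]).

    General case. Replace each [x_r] by the block of points
    [x_r, x_r q, ..., x_r q^(N_r - 1)]. A subset that contains [x_r q^(i+1)] but
    not [x_r q^i] contributes a factor [theta(1) = 0]. The remaining subsets are
    the unions of initial segments of the blocks, that is, the tuples [j] with
    [j_r <= N_r], and for these the products over pairs of points telescope to
    the entries of the matrix times [alpha] ([block_term], [block_value]). *)

Set Implicit Arguments.
Unset Strict Implicit.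
Unset Printing Implicit Defensive.

Import GRing.Theory.
Local Open Scope ring_scope.


(** * Functions with the three-term relation of theta *)

Definition thpair (F : fieldType) (th : F -> F) (x y : F) : F :=
  th (x * y) * th (x / y) / x.

Record theta_like (F : fieldType) (th : F -> F) : Prop := ThetaLike {
  theta_like1 : th 1 = 0;
  theta_likeV : forall x, x != 0 -> th x^-1 = - x^-1 * th x;
  theta_like_add : forall x y u v, x != 0 -> y != 0 -> u != 0 -> v != 0 ->
    thpair th x y * thpair th u v - thpair th x u * thpair th y v
    + thpair th x v * thpair th y u = 0 }.

Lemma prod_ord_recr_cond (F : fieldType) n (P : pred 'I_n.+1) (f : 'I_n.+1 -> F) :
  \prod_(l < n.+1 | P l) f l =
  (\prod_(l < n | P (widen_ord (leqnSn n) l)) f (widen_ord (leqnSn n) l)) *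
  (if P ord_max then f ord_max else 1).
Proof. by rewrite big_mkcond big_ord_recr -big_mkcond. Qed.

Section ThetaLike.
Variables (F : fieldType) (th : F -> F).
Hypothesis thP : theta_like th.
Local Notation E := (thpair th).

Lemma thpair_anti (x y : F) : x != 0 -> y != 0 -> E y x = - E x y.
Proof.
move=> x0 y0; rewrite /thpair (mulrC y x).
have -> : y / x = (x / y)^-1 by rewrite invf_div.
rewrite (theta_likeV thP) ?mulf_neq0 ?invr_eq0 //; field.
by rewrite x0 y0.
Qed.

Lemma thpair_add (x y u v : F) : x != 0 -> y != 0 -> u != 0 -> v != 0 ->
  E x y * E u v = E x u * E y v - E x v * E y u.
Proof.
by move=> x0 y0 u0 v0; apply/eqP; rewrite -subr_eq0 opprB addrA addrAC theta_like_add.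
Qed.

(** Lagrange interpolation for products of [n] sections [E(., w)] at [n + 1]
    nodes. In the induction, the new factor [E(z, w n)] is expanded over [v j]
    and the new node by the three-term relation; the second halves of these
    expansions add up, by the induction hypothesis at [z = v n.+1], to the term
    of the new node. *)
Lemma thpair_lagrange n (v w : nat -> F) (z : F) : z != 0 ->
    (forall j, v j != 0) -> (forall i, w i != 0) ->
    (forall i j, (i <= n)%N -> (j <= n)%N -> i != j -> E (v i) (v j) != 0) ->
  \prod_(i < n) E z (w i) =
  \sum_(j < n.+1) (\prod_(i < n) E (v j) (w i)) *
     \prod_(l < n.+1 | l != j) (E z (v l) / E (v j) (v l)).
Proof.
move=> z0 v0 w0; elim: n z z0 => [|n IHn] z z0 vE.
  rewrite big_ord0 big_ord_recl big_ord0 big_ord0 mul1r addr0 big1 //.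
  by move=> i; rewrite ord1.
have vEn i j : (i <= n)%N -> (j <= n)%N -> i != j -> E (v i) (v j) != 0.
  by move=> Hi Hj; apply: vE; apply: leqW.
have vn_neq (j : 'I_n.+1) : E (v j) (v n.+1) != 0.
  by apply: vE => //; [exact: ltnW | rewrite neq_ltn ltn_ord].
have nv_neq (j : 'I_n.+1) : E (v n.+1) (v j) != 0.
  by apply: vE => //; [exact: ltnW | rewrite neq_ltn ltn_ord orbT].
(* A different pair of nodes is used for each summand of the induction hypothesis. *)
have split_last (j : 'I_n.+1) : E z (w n) =
    E (v j) (w n) * (E z (v n.+1) / E (v j) (v n.+1))
    + E (v n.+1) (w n) * (E z (v j) / E (v n.+1) (v j)).
  have e := thpair_add z0 (w0 n) (v0 j) (v0 n.+1).
  apply: (mulIf (vn_neq j)); rewrite e (thpair_anti (v0 j) (w0 n)).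
  rewrite (thpair_anti (v0 n.+1) (w0 n)) (thpair_anti (v0 j) (v0 n.+1)).
  by field; rewrite oppr_eq0 vn_neq.
rewrite big_ord_recr [RHS]big_ord_recr /= (IHn z z0 vEn) mulr_suml.
under [LHS]eq_bigr => j _ do rewrite (split_last j) mulrDr.
rewrite big_split /=; congr (_ + _).
  apply: eq_bigr => j _; rewrite big_ord_recr [X in _ = _ * X]prod_ord_recr_cond /=.
  have -> : (ord_max != widen_ord (leqnSn n.+1) j).
    by rewrite -val_eqE /= neq_ltn ltn_ord orbT.
  by rewrite /= mulrACA.
rewrite [X in _ = X * _]big_ord_recr /= (IHn (v n.+1) (v0 _) vEn) !mulr_suml.
apply: eq_bigr => j _.
rewrite [X in _ = _ * X]prod_ord_recr_cond /= eqxx mulr1.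
have -> : \prod_(i < n.+1 | widen_ord (leqnSn n.+1) i != ord_max)
    (E z (v i) / E (v n.+1) (v i)) = \prod_(i < n.+1) (E z (v i) / E (v n.+1) (v i)).
  by apply: eq_bigl => i; rewrite -val_eqE /= neq_ltn ltn_ord.
rewrite [X in _ = _ * X](bigD1 j) //=.
have -> : \prod_(l < n.+1 | l != j) (E z (v l) / E (v j) (v l)) =
    \prod_(l < n.+1 | l != j) (E (v n.+1) (v l) / E (v j) (v l)) *
    \prod_(l < n.+1 | l != j) (E z (v l) / E (v n.+1) (v l)).
  rewrite -big_split /=; apply: eq_bigr => l lj.
  have jl : E (v j) (v l) != 0 by apply: vEn (ltn_ord j) (ltn_ord l) _; rewrite eq_sym.
  by field; rewrite nv_neq jl.
by ring.
Qed.

(** The symmetric building block in [c]: it is invariant under [c <-> t / c], and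
    it is a multiple of [E(c / tau, tau u)] when [tau ^ 2 = t]. *)
Definition thsym (t c u : F) : F := th (c * u) * th (t * u / c).

Lemma thsymE (tau c u : F) : tau != 0 -> c != 0 -> u != 0 ->
  thsym (tau ^+ 2) c u = - (tau * u) * E (c / tau) (tau * u).
Proof.
move=> tau0 c0 u0; rewrite /thsym /thpair.
have -> : c / tau * (tau * u) = c * u by field.
have -> : c / tau / (tau * u) = (tau ^+ 2 * u / c)^-1 by field; rewrite tau0 c0 u0.
rewrite (theta_likeV thP) ?mulf_neq0 ?invr_eq0 ?expf_neq0 //; field.
by rewrite tau0 c0 u0.
Qed.

(** Two combinations of products of [n] factors [thsym t c u] that agree at [n + 1]
    values of [c] agree for all [c]. The nodes must be distinct up to
    [c <-> t / c], which is what the two nonvanishing conditions express. *)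
Lemma thsym_interp (J : finType) (P : pred J) (K : J -> F) (us : J -> seq F)
    (K0 : F) (u0 : seq F) n (tau c : F) (cs : nat -> F) :
    tau != 0 -> c != 0 -> (forall j, cs j != 0) ->
    (forall i j, (i <= n)%N -> (j <= n)%N -> i != j ->
       th (cs i / cs j) != 0 /\ th (cs i * cs j / tau ^+ 2) != 0) ->
    (forall j, P j -> size (us j) = n /\ {in us j, forall u, u != 0}) ->
    size u0 = n -> {in u0, forall u, u != 0} ->
    (forall i, (i <= n)%N ->
       \sum_(j | P j) K j * \prod_(u <- us j) thsym (tau ^+ 2) (cs i) u
       = K0 * \prod_(u <- u0) thsym (tau ^+ 2) (cs i) u) ->
  \sum_(j | P j) K j * \prod_(u <- us j) thsym (tau ^+ 2) c u
  = K0 * \prod_(u <- u0) thsym (tau ^+ 2) c u.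
Proof.
move=> tau0 c0 cs0 csE usP su0 u0P eq_nodes.
pose v j := cs j / tau.
pose L (j : 'I_n.+1) :=
  \prod_(l < n.+1 | l != j) (E (c / tau) (v l) / E (v j) (v l)).
have v0 j : v j != 0 by rewrite mulf_neq0 ?invr_eq0.
have vE i j : (i <= n)%N -> (j <= n)%N -> i != j -> E (v i) (v j) != 0.
  move=> Hi Hj ij; have [h1 h2] := csE i j Hi Hj ij.
  rewrite /thpair !mulf_neq0 ?invr_eq0 //.
    by rewrite /v mulrACA -invfM -expr2.
  by have -> : v i / v j = cs i / cs j by rewrite /v; field; rewrite tau0 cs0.
have lag (s : seq F) : size s = n -> {in s, forall u, u != 0} ->
    \prod_(u <- s) thsym (tau ^+ 2) c u =
    \sum_(j < n.+1) (\prod_(u <- s) thsym (tau ^+ 2) (cs j) u) * L j.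
  move=> ss s0; pose w i := tau * nth 1 s i.
  have w0 i : w i != 0.
    rewrite mulf_neq0 //; have [lt_i|ge_i] := ltnP i (size s).
      by apply: s0; rewrite mem_nth.
    by rewrite nth_default ?oner_eq0.
  have nodeE z : z != 0 -> \prod_(u <- s) thsym (tau ^+ 2) z u =
      (\prod_(i < n) - w i) * \prod_(i < n) E (z / tau) (w i).
    move=> z0; rewrite (big_nth 1) ss big_mkord -big_split /=.
    apply: eq_bigr => i _; rewrite thsymE //.
    by apply: s0; rewrite mem_nth ?ss.
  rewrite nodeE // (@thpair_lagrange n v) ?mulf_neq0 ?invr_eq0 //.
  rewrite mulr_sumr; apply: eq_bigr => j _.
  by rewrite nodeE // mulrA.
transitivity (\sum_(j | P j) \sum_(i < n.+1)
    K j * ((\prod_(u <- us j) thsym (tau ^+ 2) (cs i) u) * L i)).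
  by apply: eq_bigr => j Pj; have [sj nzj] := usP j Pj; rewrite lag ?mulr_sumr.
rewrite exchange_big lag //= mulr_sumr; apply: eq_bigr => i _.
rewrite mulrA -(eq_nodes i (ltn_ord i)) mulr_suml.
by apply: eq_bigr => j _; rewrite mulrA.
Qed.

(** * The sum over subsets *)

(** The shifted factorial over an arbitrary function [th] in place of theta. *)
Definition thfact (z q : F) (k : nat) : F := \prod_(j < k) th (z * q ^+ j).

Section SubsetSum.
Variables (T : finType) (x : T -> F) (q a f w : F).

(** The term of the Jackson sum with all [N_r = 1], up to a factor that does not
    depend on [I]. Here [f] and [w] stand for [b q^n] and [bcd/a], with
    [n = #|A|]; with them as parameters, the induction on [#|A|] changes only
    [A] and [c]. *)
Definition subset_term (c d : F) (A I : {set T}) : F :=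
  thfact f q #|I| * thfact (a * q / w) q #|I| * (w / (c * d)) ^+ #|I|
  * q ^+ 'C(#|I|, 2)
  * \prod_(#|I| <= j < #|A|) (th (a * q ^+ j.+1 / c) * th (a * q ^+ j.+1 / d))
  * \prod_(r in A :\: I)
      (th (f / (q * a * x r)) * th (w * x r) / th (a * x r * q ^+ #|I|.+1))
  * \prod_(r in I) (th (c * x r) * th (d * x r) / (x r * th (a * x r * q ^+ #|I|)))
  * \prod_(r in A :\: I) \prod_(s in I) (th (q * x r / x s) / th (x r / x s)).

Definition subset_value (c d : F) (A : {set T}) : F :=
  \prod_(j < #|A|) (th (w * q ^+ j / c) * th (w * q ^+ j / d))
  * \prod_(r in A) th (a * q ^+ #|A| / (c * d * x r)).

Hypotheses (q0 : q != 0) (a0 : a != 0) (w0 : w != 0).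
Hypothesis x0 : forall r, x r != 0.

(** At [c = 1 / x m] the factor of the pair [(m, s)] has a denominator that
    cancels [th(c x_s)] and a numerator that turns into [th((c / q) x_s)]. *)
Lemma subset_term_node (c d : F) (A I : {set T}) (m : T) :
    c != 0 -> d != 0 -> m \in A -> I \subset A :\ m ->
    c = (x m)^-1 -> 
    (forall s, s \in A -> s != m -> th (x m / x s) != 0) ->
    (th (a * x m * q ^+ #|I|.+1) != 0) ->
  subset_term c d A I =
  th (f / (q * a * x m)) * th (w * x m) * th (a * q ^+ #|A| / d)
  * subset_term (c / q) d (A :\ m) I.
Proof.
move=> c0 d0 mA IA cE xm0 axm0.
have mI : m \notin I by apply/negP => /(subsetP IA); rewrite !inE eqxx.
have kn : (#|I| <= #|A :\ m|)%N by exact: subset_leq_card.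
have nE : #|A| = #|A :\ m|.+1 by rewrite (cardsD1 m A) mA.
have mAI : m \in A :\: I by rewrite inE mI.
have AIE : (A :\: I) :\ m = (A :\ m) :\: I by rewrite !setDDl setUC.
rewrite /subset_term nE; set k := #|I| in axm0 kn *; set n := #|_ :\ m| in kn *.
rewrite (big_setD1 m mAI) [X in _ * X = _](big_setD1 m mAI) /= AIE.
have -> : \prod_(k <= j < n.+1) (th (a * q ^+ j.+1 / c) * th (a * q ^+ j.+1 / d)) =
   th (a * x m * q ^+ k.+1) * th (a * q ^+ n.+1 / d) * 
   \prod_(k <= j < n) (th (a * q ^+ j.+1 / (c / q)) * th (a * q ^+ j.+1 / d)).
  rewrite !big_split /= big_nat_recl // [X in _ * X = _]big_nat_recr //=.
  have -> : \prod_(k <= i < n) th (a * q ^+ i.+2 / c) =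
            \prod_(k <= i < n) th (a * q ^+ i.+1 / (c / q)).
    by apply: eq_bigr => i _; congr th; rewrite exprS; field; rewrite c0 q0.
  have -> : a * q ^+ k.+1 / c = a * x m * q ^+ k.+1 by rewrite cE invrK; ring.
  by ring.
have -> : w / (c / q * d) = w / (c * d) * q by field; rewrite c0 d0 q0.
set P1 := \prod_(r in I) (th (c * x r) * _ / _); set P2 := \prod_(s in I) _.
set P1' := \prod_(r in I) (th (c / q * x r) * _ / _).
have P12 : P1 * P2 = q ^+ k * P1'.
  have -> : q ^+ k = \prod_(s in I) q by rewrite prodr_const.
  rewrite /P1 /P2 /P1' -!big_split /=; apply: eq_bigr => s sI.
  have sA : s \in A :\ m by apply: (subsetP IA).
  have ths : th (x m / x s) != 0 by move: sA; rewrite !inE => /andP[? ?]; apply: xm0.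
  have -> : q * x m / x s = (c / q * x s)^-1.
    by rewrite cE; field; rewrite q0 x0 x0.
  have -> : c * x s = (x m / x s)^-1 by rewrite cE; field; rewrite !x0.
  rewrite !(theta_likeV thP) ?mulf_neq0 ?invr_eq0 // cE !(invfM (x s)).
  move: (th (a * x s * q ^+ k))^-1 => axs.
  by field; rewrite ths !x0 q0.
rewrite (exprMn k _ q); move: ((w / (c * d)) ^+ k) => wk.
set P3 := \prod_(r in _ :\: _) _; set P4 := \prod_(r in _ :\: _) _.
set P5 := \prod_(k <= j < n) _; set t1 := thfact f q k; set t2 := thfact _ q k.
set P6 := th (f / (q * a * x m)); set P7 := th (w * x m).
set P8 := th (a * x m * _); set P9 := th (a * q ^+ n.+1 / d).
rewrite -/P8 in axm0.
transitivity (t1 * t2 * wk * q ^+ 'C(k, 2) * (P9 * P5)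
  * (P6 * P7 * P3) * P4 * (P1 * P2)); first by field.
by rewrite P12; ring.
Qed.

Lemma subset_value_node (c d : F) (A : {set T}) (m : T) :
    c != 0 -> d != 0 -> m \in A -> c = (x m)^-1 ->
    a * w * q ^+ #|A| = f * c * d ->
  subset_value c d A =
  th (f / (q * a * x m)) * th (w * x m) * th (a * q ^+ #|A| / d)
  * subset_value (c / q) d (A :\ m).
Proof.
move=> c0 d0 mA cE.
have nE : #|A| = #|A :\ m|.+1 by rewrite (cardsD1 m A) mA.
rewrite /subset_value nE; set n := #|_ :\ m| => bal.
rewrite (big_setD1 m mA) /= !big_split /= big_ord_recl.
rewrite [\prod_(j < n.+1) th (w * q ^+ j / d)]big_ord_recr /=.
have -> : \prod_(i < n) th (w * q ^+ bump 0 i / c) = \prod_(i < n) th (w * q ^+ i / (c / q)).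
  apply: eq_bigr => i _; congr th; rewrite /bump /= exprS.
  by field; rewrite c0 q0.
have -> : \prod_(r in A :\ m) th (a * q ^+ n.+1 / (c * d * x r)) =
          \prod_(r in A :\ m) th (a * q ^+ n / (c / q * d * x r)).
  apply: eq_bigr => r _; congr th; rewrite exprS.
  by field; rewrite c0 q0 d0 x0.
have -> : f / (q * a * x m) = w * q ^+ n / d.
  have -> : f = a * w * q ^+ n.+1 / (c * d) by rewrite bal; field; rewrite c0 d0.
  by rewrite cE exprS; field; rewrite d0 q0 a0 x0.
have -> : a * q ^+ n.+1 / (c * d * x m) = a * q ^+ n.+1 / d.
  by rewrite cE; field; rewrite d0 x0.
have -> : w * q ^+ 0 / c = w * x m by rewrite cE expr0 mulr1 invrK.
by ring.
Qed.

Lemma prodr_expr_bin (n : nat) : \prod_(j < n) q ^+ j = q ^+ 'C(n, 2).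
Proof. by rewrite prodrXr -bin2_sum big_mkord. Qed.

(** At [c = a q^n] the full subset gives the whole sum: the balancing condition
    reduces to [w = f d], and each factor of the value is a factor of the term
    up to the inversion [x -> 1 / x]. *)
Lemma subset_term_top (c d : F) (A : {set T}) :
    d != 0 -> c = a * q ^+ #|A| ->
    a * w * q ^+ #|A| = f * c * d ->
    (forall r, r \in A -> th (a * x r * q ^+ #|A|) != 0) ->
  subset_term c d A A = subset_value c d A.
Proof.
move=> d0 cE bal axA; rewrite /subset_term /subset_value setDv !big_set0.
rewrite big_geq // !mulr1; set n := #|A| in cE bal axA *.
have qn0 : q ^+ n != 0 by rewrite expf_neq0.
have c0 : c != 0 by rewrite cE mulf_neq0.
have wE : w = f * d.
  apply: (mulfI (mulf_neq0 a0 qn0)); rewrite mulrAC bal cE; ring.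
have -> : \prod_(r in A) (th (c * x r) * th (d * x r) / (x r * th (a * x r * q ^+ n)))
   = \prod_(r in A) (- d) * \prod_(r in A) th (a * q ^+ n / (c * d * x r)).
  rewrite -big_split /=; apply: eq_bigr => r rA.
  have -> : a * q ^+ n / (c * d * x r) = (d * x r)^-1.
    by rewrite cE; field; rewrite a0 d0 x0 qn0.
  have -> : c * x r = a * x r * q ^+ n by rewrite cE mulrAC.
  rewrite (theta_likeV thP) ?mulf_neq0 //; field.
  by rewrite axA // x0 d0.
rewrite prodr_const -/n mulrA; congr (_ * _); rewrite big_split /=.
have -> : \prod_(i < n) th (w * q ^+ i / d) = thfact f q n.
  by apply: eq_bigr => i _; rewrite wE; congr th; field.
have -> : \prod_(i < n) th (w * q ^+ i / c) =
   \prod_(i < n) ((w / c * (- 1)) * q ^+ (n - i.+1)) * thfact (a * q / w) q n.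
  rewrite (reindex_inj rev_ord_inj) /= -big_split /=; apply: eq_bigr => i _.
  have e : q ^+ n = q ^+ (n - i.+1) * (q * q ^+ i) by rewrite -exprS -exprD subnK.
  have := qn0; rewrite e mulf_eq0 negb_or => /andP[h1 h2].
  have -> : w * q ^+ (n - i.+1) / c = (a * q / w * q ^+ i)^-1.
    rewrite cE e; field; rewrite a0 w0 h1.
    by move: h2; rewrite mulf_eq0 negb_or => /andP[-> ->].
  rewrite (theta_likeV thP); last by rewrite !mulf_neq0 ?expf_neq0 ?invr_eq0.
  congr (_ * _); rewrite cE e; field; rewrite a0 w0 h1.
  by move: h2; rewrite mulf_eq0 negb_or => /andP[-> ->].
rewrite big_split /= prodr_const card_ord.
have -> : \prod_(i < n) q ^+ (n - i.+1) = q ^+ 'C(n, 2).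
  by rewrite -prodr_expr_bin [RHS](reindex_inj rev_ord_inj) /=.
have -> : (w / c * -1) ^+ n = (w / (c * d)) ^+ n * (- d) ^+ n.
  by rewrite -exprMn; congr (_ ^+ _); field; rewrite c0 d0.
by ring.
Qed.

(** The arguments [u] of the [#|A|] factors [thsym t c u] in the term of [I]: the
    points of [I], and one for each factor of [(aq^(k+1)/c, aq^(k+1)/d)_(n-k)]. *)
Definition term_args (t : F) (A I : {set T}) : seq F :=
  [seq x r | r <- enum I] ++ [seq a * q ^+ j.+1 / t | j <- index_iota #|I| #|A|].

Definition term_coef (t : F) (A I : {set T}) : F :=
  thfact f q #|I| * thfact (a * q / w) q #|I| * (w / t) ^+ #|I|
  * q ^+ 'C(#|I|, 2)
  * \prod_(r in A :\: I)
      (th (f / (q * a * x r)) * th (w * x r) / th (a * x r * q ^+ #|I|.+1))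
  * \prod_(r in I) (x r * th (a * x r * q ^+ #|I|))^-1
  * \prod_(r in A :\: I) \prod_(s in I) (th (q * x r / x s) / th (x r / x s)).

Lemma subset_term_thsym (t c : F) (A I : {set T}) : t != 0 -> c != 0 ->
  subset_term c (t / c) A I =
  term_coef t A I * \prod_(u <- term_args t A I) thsym t c u.
Proof.
move=> t0 c0; rewrite /subset_term /term_coef big_cat !big_map big_enum /=.
have -> : \prod_(r in I) (th (c * x r) * th (t / c * x r) / (x r * th (a * x r * q ^+ #|I|)))
  = \prod_(r in I) thsym t c (x r) * \prod_(r in I) (x r * th (a * x r * q ^+ #|I|))^-1.
  by rewrite -big_split /=; apply: eq_bigr => r _; rewrite /thsym [t / c * _]mulrAC.
have -> : \prod_(#|I| <= j < #|A|) (th (a * q ^+ j.+1 / c) * th (a * q ^+ j.+1 / (t / c)))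
  = \prod_(#|I| <= j < #|A|) thsym t c (a * q ^+ j.+1 / t).
  apply: eq_bigr => j _; rewrite /thsym mulrC; congr (th _ * th _).
    by field; rewrite t0 c0.
  by field; rewrite t0 c0.
have -> : c * (t / c) = t by field.
by ring.
Qed.

Lemma subset_value_thsym (t c : F) (A : {set T}) : t != 0 -> c != 0 ->
  subset_value c (t / c) A =
  \prod_(r in A) th (a * q ^+ #|A| / (t * x r))
  * \prod_(u <- [seq w * q ^+ j / t | j <- index_iota 0 #|A|]) thsym t c u.
Proof.
move=> t0 c0; rewrite /subset_value mulrC; congr (_ * _).
  by apply: eq_bigr => r _; rewrite [c * _]mulrC divfK.
rewrite big_map big_mkord; apply: eq_bigr => j _; rewrite /thsym mulrC.
by congr (th _ * th _); field; rewrite t0 c0.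
Qed.

(** Induction on [#|A|] by interpolation in [c] with [cd] fixed. The last two
    hypotheses say that the nodes [1 / x r] and [a q^#|A|] are distinct up to
    [c <-> cd / c]; the power [q ^ i] in the first of them absorbs the passage
    from [cd] to [cd / q] in the induction. *)
Lemma subset_sum_generic (A : {set T}) (c d : F) :
    (forall t : F, exists tau, tau ^+ 2 = t) ->
    c != 0 -> d != 0 -> a * w * q ^+ #|A| = f * c * d ->
    (forall r k, r \in A -> (k <= #|A|)%N -> th (a * x r * q ^+ k) != 0) ->
    (forall r s, r \in A -> s \in A -> r != s -> th (x r / x s) != 0) ->
    (forall r s i, r \in A -> s \in A -> r != s ->
        th (q ^+ i / (c * d * x r * x s)) != 0) ->
    (forall r, r \in A -> th (a * q ^+ #|A| / (c * d * x r)) != 0) ->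
  \sum_(I : {set T} | I \subset A) subset_term c d A I = subset_value c d A.
Proof.
move=> sqrtF.
have [n] := ubnP #|A|; elim: n A c d => // n IHn A c d leAn c0 d0 bal axA xxA cdxx cdx.
(* [cs] lists the nodes, the top node [a q^#|A|] first. *)
have [tau tauE] := sqrtF (c * d).
have t0 : c * d != 0 by rewrite mulf_neq0.
have tau0 : tau != 0.
  by apply: contra_neq t0 => tau0; rewrite -tauE tau0 expr0n.
have dE z : z = c -> d = (tau ^+ 2) / z by move=> ->; rewrite tauE mulrAC divff ?mul1r.
have aq0 k : a * q ^+ k != 0 by rewrite mulf_neq0 ?expf_neq0.
pose cs i := nth 1 (a * q ^+ #|A| :: [seq (x r)^-1 | r <- enum A]) i.
have cs_succ i : (i < #|A|)%N -> exists2 m, m \in A & cs i.+1 = (x m)^-1.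
  move=> ltiA; have [m0 m0A] : exists m0, m0 \in A.
    by apply/card_gt0P; apply: leq_ltn_trans ltiA.
  exists (nth m0 (enum A) i); first by rewrite -mem_enum mem_nth // -cardE.
  by rewrite /cs /= (nth_map m0) // -cardE.
have cs0 i : cs i != 0.
  case: i => [|i]; first exact: aq0.
  have [/cs_succ[m _ ->]|le_Ai] := ltnP i #|A|; first by rewrite invr_eq0.
  by rewrite /cs /= nth_default ?oner_eq0 // size_map -cardE.
have xinj : {in A &, injective x}.
  move=> r s rA sA xrs; apply/eqP/negPn/negP => rs.
  by have := xxA _ _ rA sA rs; rewrite xrs divff // (theta_like1 thP) eqxx.
have tE : tau ^+ 2 = c * d by [].
rewrite {1 2}(dE c) //.
under eq_bigr => I _ do rewrite subset_term_thsym ?tE //.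
rewrite subset_value_thsym ?tE // -tE.
apply: (@thsym_interp _ _ _ _ _ _ #|A| tau c cs) => //.

- move=> i j le_i le_j ij; rewrite tE.
  have top_node m k : m \in A -> cs k.+1 = (x m)^-1 ->
     th (cs 0%N / cs k.+1) != 0 /\ th (cs 0%N * cs k.+1 / (c * d)) != 0.
    move=> mA ->; rewrite /cs /= invrK mulrAC axA //; split=> //.
    by rewrite -mulrA -invfM [x m * _]mulrC cdx.
  have thV z : z != 0 -> th z != 0 -> th z^-1 != 0.
    by move=> z0 thz; rewrite (theta_likeV thP) // mulf_neq0 // oppr_eq0 invr_eq0.
  case: i j le_i le_j ij => [|i] [|j] // le_i le_j ij.
  + by have [m mA e] := cs_succ _ le_j; exact: top_node e.
  + have [m mA e] := cs_succ _ le_i; have [h1 h2] := top_node _ _ mA e.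
    have -> : cs i.+1 / cs 0%N = (cs 0%N / cs i.+1)^-1 by rewrite invf_div.
    by rewrite [cs i.+1 * _]mulrC thV // mulf_neq0 ?invr_eq0.
  + have [r rA er] := cs_succ _ le_i; have [s sA es] := cs_succ _ le_j.
    have rs : r != s.
      move: ij; apply: contra_neq => rs.
      have : cs i.+1 = cs j.+1 by rewrite er es rs.
      rewrite /cs /= !(nth_map r) -?cardE // => /invr_inj /xinj eq_ij.
      have nthA k : (k < #|A|)%N -> nth r (enum A) k \in A.
        by move=> ltk; rewrite -mem_enum mem_nth // -cardE.
      have /eqP := eq_ij (nthA i le_i) (nthA j le_j).
      by rewrite nth_uniq ?enum_uniq -?cardE // => /eqP ->.
    have sr : s != r by rewrite eq_sym.
    rewrite er es invrK [(x r)^-1 * x s]mulrC xxA //.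
    have -> : (x r)^-1 / x s / (c * d) = q ^+ 0 / (c * d * x r * x s).
      by rewrite expr0; field; rewrite c0 d0 !x0.
    by rewrite cdxx.
- move=> I IA; rewrite size_cat !size_map -cardE size_iota subnKC ?subset_leq_card //.
  split=> // u; rewrite mem_cat => /orP[] /mapP[z _ ->] //.
  by rewrite mulf_neq0 ?aq0 // invr_eq0 tE.
- by rewrite size_map size_iota subn0.
- by move=> u /mapP[z _ ->]; rewrite !mulf_neq0 ?expf_neq0 // invr_eq0 tE.
move=> i le_i; rewrite tE.
set t := c * d in tE t0 *.
(* Moving [c] to [z] moves [d] to [t / z], so the balancing condition is kept. *)
have balE z : z != 0 -> a * w * q ^+ #|A| = f * z * (t / z).
  by move=> z0; rewrite bal /t; field.
rewrite -subset_value_thsym //.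
under eq_bigr => I _ do rewrite -subset_term_thsym //.
case: i le_i => [|i] /= ltiA.
  rewrite (bigD1 A) //= big1 => [|I /andP[IA neqIA]].
    rewrite addr0 subset_term_top ?mulf_neq0 ?invr_eq0 //; first exact: balE.
    by move=> r rA; apply: axA.
  have ltIA : (#|I| < #|A|)%N.
    by apply: proper_card; rewrite properEneq neqIA.
  rewrite /subset_term; have -> : \prod_(#|I| <= j < #|A|)
      (th (a * q ^+ j.+1 / cs 0%N) * th (a * q ^+ j.+1 / (t / cs 0%N))) = 0.
    apply/eqP; rewrite prodf_seq_eq0; apply/hasP; exists #|A|.-1.
      by rewrite mem_index_iota -ltnS (ltn_predK ltIA) ltIA /=.
    by rewrite (ltn_predK ltIA) /cs /= divff ?aq0 // (theta_like1 thP) mul0r.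
  by rewrite !(mulr0, mul0r).
have [m mA cE] := cs_succ i ltiA.
have td0 : t / cs i.+1 != 0 by rewrite mulf_neq0 ?invr_eq0.
have nE : #|A| = #|A :\ m|.+1 by rewrite (cardsD1 m A) mA.
have sub (r : T) : r \in A :\ m -> r \in A by rewrite inE => /andP[].
have cdE : cs i.+1 / q * (t / cs i.+1) = t / q by field; rewrite q0 cs0.
rewrite (bigID (fun I : {set T} => m \in I)) /= big1 ?add0r => [|I /andP[_ mI]]; last first.
  rewrite /subset_term (bigD1 m mI) /= cE mulVf // (theta_like1 thP).
  by rewrite !mul0r !(mulr0, mul0r).
transitivity (\sum_(I : {set T} | I \subset A :\ m) subset_term (cs i.+1) (t / cs i.+1) A I).
  by apply: eq_bigl => I; rewrite subsetD1.
rewrite (subset_value_node _ td0 mA) //; last exact: balE.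
rewrite -IHn ?mulf_neq0 ?invr_eq0 //.
- rewrite mulr_sumr; apply: eq_bigr => I IA; apply: subset_term_node => //.
    by move=> s sA sm; apply: xxA; rewrite // eq_sym.
  by apply: axA; rewrite // nE ltnS subset_leq_card.
- by rewrite -ltnS -nE.
- apply: (mulfI q0); rewrite mulrCA -exprS -nE (balE (cs i.+1)) //.
  by field; rewrite q0 cs0.
- by move=> r k rA le_k; apply: axA; [exact: sub | rewrite nE leqW].
- by move=> r s rA sA rs; apply: xxA; rewrite ?sub.
- move=> r s j rA sA rs; rewrite cdE.
  have -> : q ^+ j / (t / q * x r * x s) = q ^+ j.+1 / (c * d * x r * x s).
    by rewrite exprS /t; field; rewrite c0 d0 q0 !x0.
  by rewrite cdxx ?sub.
- move=> r rA; rewrite cdE.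
  have -> : a * q ^+ #|A :\ m| / (t / q * x r) = a * q ^+ #|A| / (c * d * x r).
    by rewrite nE exprS /t; field; rewrite c0 d0 q0 !x0.
  by rewrite cdx ?sub.
Qed.
End SubsetSum.
End ThetaLike.

(** * Initial segments of blocks of points *)

Section Blocks.
Variables (n : nat) (N : 'I_n -> nat).
Local Notation T := {r : 'I_n & 'I_(N r)}.
Local Notation tup := {dffun forall r : 'I_n, 'I_(N r).+1}.

Definition segment (j : tup) : {set T} := [set t : T | (tagged t < j (tag t))%N].

(** The subsets of the blocks of points on which the term does not vanish for
    trivial reasons, see [block_term_eq0]. *)
Definition lower_closed (I : {set T}) : bool :=
  [forall r : 'I_n, forall i : 'I_(N r), forall i' : 'I_(N r),
     (i' == i.+1 :> nat) ==> (Tagged (fun r => 'I_(N r)) i' \in I)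
     ==> (Tagged (fun r => 'I_(N r)) i \in I)].

(** The height of the segment of block [r] is the first index missing from [I]. *)
Definition segment_height (I : {set T}) : tup :=
  [ffun r => inord (find (fun i => Tagged (fun r => 'I_(N r)) i \notin I) (enum 'I_(N r)))].

Lemma segment_heightE I r : segment_height I r =
  find (fun i => Tagged (fun r => 'I_(N r)) i \notin I) (enum 'I_(N r)) :> nat.
Proof.
rewrite ffunE inordK // ltnS -[X in (_ <= X)%N](size_enum_ord (N r)).
exact: find_size.
Qed.

Lemma segmentK (j : tup) : segment_height (segment j) = j.
Proof.
apply/ffunP => r; apply/val_inj; rewrite /= segment_heightE.
have [lt_jN|] := ltnP (j r) (N r); last first.
  move=> le_Nj; have jN : j r = N r :> nat.
    by apply/eqP; rewrite eqn_leq le_Nj -ltnS ltn_ord.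
  rewrite hasNfind ?size_enum_ord //; apply/hasPn => i _.
  by rewrite negbK inE /= jN.
set P := (X in find X _).
have pP i : P i = (j r <= i)%N by rewrite /P inE /= -leqNgt.
apply/eqP; rewrite eqn_leq; apply/andP; split.
  rewrite leqNgt; apply/negP => /(before_find (Ordinal lt_jN)).
  by rewrite pP nth_enum_ord ?leqnn.
rewrite leqNgt; apply/negP => lt_fj.
have lt_fN : (find P (enum 'I_(N r)) < N r)%N by apply: ltn_trans lt_fj _.
have hasP : has P (enum 'I_(N r)) by rewrite has_find size_enum_ord.
by have := nth_find (Ordinal lt_jN) hasP; rewrite pP nth_enum_ord // leqNgt lt_fj.
Qed.

Lemma lower_closed_segment (j : tup) : lower_closed (segment j).
Proof.
apply/forallP => r; apply/forallP => i; apply/forallP => i'.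
by apply/implyP => /eqP e; apply/implyP; rewrite !inE /= e; apply: ltnW.
Qed.

Lemma segment_heightK (I : {set T}) : lower_closed I -> segment (segment_height I) = I.
Proof.
move=> lowI; apply/setP => -[r i]; rewrite inE /= segment_heightE.
set P := (X in find X _).
have nth_i (k : nat) : (k < N r)%N -> nth i (enum 'I_(N r)) k = k :> nat.
  by move=> ltk; rewrite nth_enum_ord.
apply/idP/idP => [lt_if|iI].
  have := before_find i lt_if; rewrite /P => /negbFE.
  by have -> : nth i (enum 'I_(N r)) i = i by apply/val_inj; rewrite /= nth_i.
rewrite ltnNge; apply/negP => le_fi.
have lt_fN : (find P (enum 'I_(N r)) < N r)%N by apply: leq_ltn_trans le_fi _.
have hasP : has P (enum 'I_(N r)) by rewrite has_find size_enum_ord.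
suff up (k : 'I_(N r)) : (find P (enum 'I_(N r)) <= k)%N -> P k.
  by have := up i le_fi; rewrite /P iI.
case: k => k ltk /=; elim: k ltk => [|k IHk] ltk.
  rewrite leqn0 => /eqP f0; have := nth_find i hasP; rewrite f0.
  by have -> : nth i (enum 'I_(N r)) 0 = Ordinal ltk by apply/val_inj; rewrite /= nth_i.
rewrite leq_eqVlt => /orP[/eqP fk|lt_fk].
  have := nth_find i hasP; rewrite fk.
  by have -> : nth i (enum 'I_(N r)) k.+1 = Ordinal ltk by apply/val_inj; rewrite /= nth_i.
have := IHk (ltnW ltk) lt_fk; rewrite /P; apply: contra => kI.
have /forallP/(_ r)/forallP/(_ (Ordinal (ltnW ltk)))/forallP/(_ (Ordinal ltk)) := lowI.
by rewrite /= eqxx /= => /implyP /(_ kI).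
Qed.

Lemma sum_lower_closed (V : nmodType) (g : {set T} -> V) :
    (forall I, ~~ lower_closed I -> g I = 0) ->
  \sum_(I : {set T}) g I = \sum_(j : tup) g (segment j).
Proof.
move=> g0; rewrite (bigID lower_closed) /= [X in _ + X]big1 // addr0.
rewrite (reindex_onto segment segment_height) /=; last exact: segment_heightK.
by apply: eq_bigl => j; rewrite lower_closed_segment segmentK eqxx.
Qed.

Variables (R : Type) (idx : R) (op : Monoid.com_law idx).

Lemma big_segment (j : tup) (phi : 'I_n -> nat -> R) :
  \big[op/idx]_(t in segment j) phi (tag t) (tagged t) =
  \big[op/idx]_(r < n) \big[op/idx]_(i < j r) phi r i.
Proof.
transitivity (\big[op/idx]_(r < n) \big[op/idx]_(i < N r | (i < j r)%N) phi r i).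
  by rewrite sig_big_dep /=; apply: eq_bigl => -[r i]; rewrite inE.
by apply: eq_bigr => r _; rewrite (big_ord_widen (N r) (phi r)) // -ltnS ltn_ord.
Qed.

Lemma big_segmentC (j : tup) (phi : 'I_n -> nat -> R) :
  \big[op/idx]_(t in setT :\: segment j) phi (tag t) (tagged t) =
  \big[op/idx]_(r < n) \big[op/idx]_(j r <= i < N r) phi r i.
Proof.
transitivity (\big[op/idx]_(r < n) \big[op/idx]_(i < N r | (j r <= i)%N) phi r i).
  by rewrite sig_big_dep /=; apply: eq_bigl => -[r i]; rewrite !inE andbT -leqNgt.
by apply: eq_bigr => r _; rewrite big_geq_mkord.
Qed.

Lemma big_blocks (phi : 'I_n -> nat -> R) :
  \big[op/idx]_(t in [set: T]) phi (tag t) (tagged t) =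
  \big[op/idx]_(r < n) \big[op/idx]_(i < N r) phi r i.
Proof. by rewrite sig_big_dep; apply: eq_bigl => t; rewrite inE. Qed.

End Blocks.

Lemma card_segment n (N : 'I_n -> nat) (j : {dffun forall r : 'I_n, 'I_(N r).+1}) :
  #|segment j| = (\sum_(r < n) j r)%N.
Proof.
rewrite -sum1_card (@big_segment n N nat 0%N addn j (fun _ _ => 1%N)).
by apply: eq_bigr => r _; rewrite sum1_card card_ord.
Qed.

Lemma card_blocks n (N : 'I_n -> nat) :
  #|[set: {r : 'I_n & 'I_(N r)}]| = (\sum_(r < n) N r)%N.
Proof.
rewrite -sum1_card (@big_blocks n N nat 0%N addn (fun _ _ => 1%N)).
by apply: eq_bigr => r _; rewrite sum1_card card_ord.
Qed.

(** * Products over segments of geometric progressions *)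

Lemma sqrn_bin2 k : (k * k = k + 2 * 'C(k, 2))%N.
Proof. by elim: k => // k IHk; rewrite binS bin1; lia. Qed.

Lemma bin2_sum_pairs n (j : 'I_n -> nat) :
  'C(\sum_(r < n) j r, 2) =
  (\sum_(r < n) 'C(j r, 2) + \sum_(r < n) \sum_(s < n | r < s) j r * j s)%N.
Proof.
set k := (\sum_(r < n) j r)%N; set S := (\sum_(r < n) \sum_(s < n | _) _)%N.
have kk : (k * k = k + 2 * (\sum_(r < n) 'C(j r, 2)) + 2 * S)%N.
  have -> : (k * k = \sum_(r < n) \sum_(s < n) j r * j s)%N.
    by rewrite big_distrl /=; apply: eq_bigr => r _; rewrite big_distrr.
  have -> : (\sum_(r < n) \sum_(s < n) j r * j s =
      \sum_(r < n) j r * j r + (S + \sum_(r < n) \sum_(s < n | s < r) j r * j s))%N.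
    rewrite -!big_split /=; apply: eq_bigr => r _.
    rewrite (bigD1 r) //=; congr addn.
    rewrite (bigID (fun s : 'I_n => (r < s)%N)) /=; congr addn; apply: eq_bigl => s.
      by rewrite -val_eqE /= neq_ltn; case: ltngtP.
    by rewrite -val_eqE /= neq_ltn -leqNgt; case: ltngtP.
  have -> : (\sum_(r < n) \sum_(s < n | s < r) j r * j s = S)%N.
    rewrite /S (exchange_big_dep xpredT) //=; apply: eq_bigr => r _.
    by apply: eq_bigr => s _; rewrite mulnC.
  have -> : (\sum_(r < n) j r * j r = k + 2 * \sum_(r < n) 'C(j r, 2))%N.
    by rewrite big_distrr -big_split; apply: eq_bigr => r _; rewrite sqrn_bin2.
  by lia.
by have := sqrn_bin2 k; lia.
Qed.

Section BlockProducts.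
Variables (F : fieldType) (th : F -> F) (q : F).
Hypothesis (q0 : q != 0).
Local Notation tfact := (thfact th).

Lemma thfactD z m k : tfact z q (m + k) = tfact z q m * tfact (z * q ^+ m) q k.
Proof.
rewrite /thfact big_split_ord; congr (_ * _); apply: eq_bigr => i _ //=.
by rewrite exprD mulrA.
Qed.

Lemma prod_nat_shift (phi : nat -> F) m k :
  \prod_(m <= i < k) phi i = \prod_(i < k - m) phi (i + m)%N.
Proof. by rewrite -{1}[m]add0n big_addn big_mkord. Qed.

Lemma thfact_split z m k : (m <= k)%N ->
  tfact z q k = tfact z q m * \prod_(m <= i < k) th (z * q ^+ i).
Proof.
move=> mk; rewrite -{1}(subnKC mk) thfactD prod_nat_shift; congr (_ * _).
by apply: eq_bigr => i _; rewrite addnC exprD mulrA.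
Qed.

Lemma prod_rev_tail z m k : (m <= k)%N ->
  \prod_(m <= i < k) th (z / q ^+ i.+1) = tfact (z / q ^+ k) q (k - m).
Proof.
move=> mk; rewrite prod_nat_shift (reindex_inj rev_ord_inj) /=.
apply: eq_bigr => i _; congr th; rewrite -mulrA; congr (_ * _).
have kE : ((k - m - i.+1 + m).+1 + i = k)%N by have := ltn_ord i; lia.
have -> : q ^- k = q ^- ((k - m - i.+1 + m).+1 + i) by rewrite kE.
by rewrite exprD; field; rewrite !expf_neq0.
Qed.

(** The inner product telescopes to [th(qu q^i) / th(qu q^(i - js))]; the outer
    one is then a quotient of shifted factorials. *)
Lemma prod_block_pair (u : F) (jr js k : nat) : (jr <= k)%N ->
    (forall i i', (jr <= i)%N -> (i' < js)%N -> th (q ^+ i / q ^+ i' * u) != 0) ->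
    (forall i, th (q * u * q ^+ i) != 0) ->
  \prod_(jr <= i < k) \prod_(i' < js)
     (th (q * (q ^+ i / q ^+ i' * u)) / th (q ^+ i / q ^+ i' * u))
  = tfact (q * u) q k
    / (tfact (q * u) q jr * tfact (q ^ (1 + jr%:Z - js%:Z) * u) q (k - jr)).
Proof.
move=> jk th0 th1.
have inner i : (jr <= i)%N -> \prod_(i' < js)
     (th (q * (q ^+ i / q ^+ i' * u)) / th (q ^+ i / q ^+ i' * u))
   = th (q * u * q ^+ i) / th (q * u * q ^+ i / q ^+ js).
  move=> le_i; have : forall i', (i' < js)%N -> th (q ^+ i / q ^+ i' * u) != 0.
    by move=> i'; apply: th0.
  elim: (js) => [|m IHm] thm0.
    by rewrite big_ord0 expr0 divr1 divff.
  rewrite big_ord_recr /= IHm => [|i' lti']; last by rewrite thm0 // ltnW.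
  have -> : q * (q ^+ i / q ^+ m * u) = q * u * q ^+ i / q ^+ m by ring.
  have -> : q * u * q ^+ i / q ^+ m.+1 = q ^+ i / q ^+ m * u.
    by rewrite exprS; field; rewrite q0 expf_neq0.
  case: m IHm thm0 => [|m] IHm thm0.
    by rewrite !expr0 !divr1; field; rewrite th1 -[q ^+ i]divr1 -(expr0 q) thm0.
  have : th (q * u * q ^+ i / q ^+ m.+1) != 0.
    have -> : q * u * q ^+ i / q ^+ m.+1 = q ^+ i / q ^+ m * u.
      by rewrite exprS; field; rewrite q0 expf_neq0.
    by rewrite thm0.
  by move=> h; rewrite mulrA divfK.
transitivity (\prod_(jr <= i < k) (th (q * u * q ^+ i) / th (q * u * q ^+ i / q ^+ js))).
  by apply: eq_big_nat => i /andP[/inner].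
rewrite big_split /= prodfV (thfact_split _ jk) invfM mulrACA.
rewrite mulfV ?mul1r; last by apply/prodf_neq0 => i _; exact: th1.
congr (_ / _); rewrite prod_nat_shift; apply: eq_bigr => i _; congr th.
rewrite addrAC !expfzDr // -exprnN expr1z -exprnP exprD.
by ring.
Qed.

(** The four products are consecutive pieces of one shifted factorial. *)
Lemma prod_block_denom (z : F) (j k N : nat) : (j <= N)%N ->
  tfact z q k * th (z * q ^+ (j + k)) * \prod_(i < j) th (z * q ^+ i * q ^+ k)
    * \prod_(j <= i < N) th (z * q ^+ i * q ^+ k.+1)
  = th z * tfact (z * q) q (N + k).
Proof.
move=> jN.
have -> : th z * tfact (z * q) q (N + k) = tfact z q (k + j + 1 + (N - j)).
  have -> : (k + j + 1 + (N - j) = 1 + (N + k))%N by lia.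
  by rewrite (thfactD z 1) {2}/thfact big_ord_recl big_ord0 expr0 !mulr1.
rewrite !thfactD prod_nat_shift {4}/thfact big_ord_recl big_ord0 expr0 !mulr1.
rewrite -(mulrA (tfact z q k)) [th _ * _]mulrC mulrA.
congr (_ * _ * _ * _); rewrite ?[(k + j)%N]addnC //; apply: eq_bigr => i _; congr th.
  by rewrite -!mulrA -!exprD addnC.
by rewrite -!mulrA -!exprD; congr (_ * _ ^+ _); lia.
Qed.

Lemma prod_block_denomV (z : F) (j k N : nat) : (j <= N)%N ->
    (forall i, th (z * q ^+ i) != 0) ->
  th (z * q ^+ (j + k)) / th z * tfact z q k / tfact (z * q) q (N + k)
  = (\prod_(i < j) th (z * q ^+ i * q ^+ k)
     * \prod_(j <= i < N) th (z * q ^+ i * q ^+ k.+1))^-1.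
Proof.
move=> jN thz; have := prod_block_denom z k jN.
have z0 : th z != 0 by have := thz 0%N; rewrite expr0 mulr1.
have zq0 : tfact (z * q) q (N + k) != 0.
  by apply/prodf_neq0 => i _; rewrite -mulrA -exprS thz.
set P1 := \prod_(i < j) _; set P2 := \prod_(j <= i < N) _ => e.
have P10 : P1 != 0 by apply/prodf_neq0 => i _; rewrite -mulrA -exprD thz.
have P20 : P2 != 0.
  by rewrite prodf_seq_neq0; apply/allP => i _ /=; rewrite -mulrA -exprD thz.
have P120 : P1 * P2 != 0 by rewrite mulf_neq0.
apply: (mulIf P120); rewrite mulVf //; apply: (mulfI (mulf_neq0 z0 zq0)).
by rewrite mulr1 -[RHS]e; field; rewrite z0 zq0.
Qed.

(** The power of [q] in [alpha] comes from the points of the segments: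
    [C(|j|, 2) - sum_r C(j_r, 2) = sum_(r < s) j_r j_s]. *)
Lemma prod_block_points m (X : 'I_m -> F) (j : 'I_m -> nat) :
  q ^+ 'C(\sum_(r < m) j r, 2) * \prod_(r < m) \prod_(i < j r) (X r * q ^+ i)^-1
  = q ^+ (\sum_(r < m) \sum_(s < m | (r < s)%N) j r * j s) * \prod_(r < m) X r ^- j r.
Proof.
have -> : \prod_(r < m) \prod_(i < j r) (X r * q ^+ i)^-1
   = q ^- (\sum_(r < m) 'C(j r, 2)) * \prod_(r < m) X r ^- j r.
  rewrite -exprVn -prodrXr -big_split /=; apply: eq_bigr => r _.
  rewrite prodfV big_split /= prodr_const card_ord prodr_expr_bin.
  by rewrite invfM exprVn mulrC.
rewrite bin2_sum_pairs exprD mulrACA mulfV ?mul1r //.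
by rewrite expf_neq0.
Qed.
End BlockProducts.

(** * From the sum over subsets to the sum over tuples *)

Section BlockSum.
Variables (F : fieldType) (th : F -> F) (q : F).
Hypotheses (q0 : q != 0).
Variables (n : nat) (N : 'I_n -> nat) (x : 'I_n -> F) (a b c d : F).
Hypotheses (a0 : a != 0) (b0 : b != 0) (c0 : c != 0) (d0 : d != 0).
Hypothesis x0 : forall r, x r != 0.
Local Notation T := {r : 'I_n & 'I_(N r)}.
Local Notation fact z k := (thfact th z q k%N).
Local Notation w := (b * c * d / a).

Definition block_point (t : T) : F := x (tag t) * q ^+ tagged t.

(** The factor, independent of the summation index, by which the sum over subsets
    differs from the sum defining a WP Bailey pair. *)
Definition block_weight : F := fact b (\sum_(r < n) N r)%N
  / (fact (a * q / c) (\sum_(r < n) N r)%N * fact (a * q / d) (\sum_(r < n) N r)%N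
     * \prod_(r < n) fact (w * x r) (N r)
     * \prod_(r < n) \prod_(s < n) fact (q * x r / x s) (N r)).

Let wxE r : b * c * d * x r / a = w * x r. Proof. by rewrite mulrAC. Qed.

Let expq k : q ^+ k != 0. Proof. exact: expf_neq0. Qed.

Lemma block_value :
  (forall r m, fact (b * c * d * x r / a) m != 0) ->
  block_weight * subset_value th block_point q a w c d [set: T] =
  fact b (\sum_(r < n) N r)%N * fact (b * c / a) (\sum_(r < n) N r)%N
    * fact (b * d / a) (\sum_(r < n) N r)%N
  / (fact (a * q / c) (\sum_(r < n) N r)%N * fact (a * q / d) (\sum_(r < n) N r)%N
     * \prod_(r < n) \prod_(s < n) fact (q * x r / x s) (N r))
  * \prod_(r < n) (fact (a * q ^ (1 + (\sum_(r < n) N r)%N%:Z - (N r)%:Z) / (c * d * x r)) (N r)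
                   / fact (b * c * d * x r / a) (N r)).
Proof.
move=> bcdx0; have wx0 r k : fact (w * x r) k != 0 by rewrite -wxE.
rewrite [X in _ = _ * X](eq_bigr (fun r => fact (a * q ^ (1 + (\sum_(r < n) N r)%N%:Z - (N r)%:Z)
  / (c * d * x r)) (N r) / fact (w * x r) (N r))) => [|r _]; last by rewrite wxE.
 rewrite /subset_value card_blocks; set m := (\sum_(r < n) N r)%N.
have -> : \prod_(j < m) (th (w * q ^+ j / c) * th (w * q ^+ j / d))
    = fact (b * d / a) m * fact (b * c / a) m.
  rewrite big_split; congr (_ * _); apply: eq_bigr => j _; congr th.
    by field; rewrite a0 c0.
  by field; rewrite a0 d0.
rewrite (@big_blocks n N F 1 *%R (fun r i => th (a * q ^+ m / (c * d * (x r * q ^+ i))))).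
have -> : \prod_(r < n) \prod_(i < N r) th (a * q ^+ m / (c * d * (x r * q ^+ i)))
  = \prod_(r < n) fact (a * q ^ (1 + m%:Z - (N r)%:Z) / (c * d * x r)) (N r).
  apply: eq_bigr => r _.
  have := @prod_rev_tail F th q q0 (a * q ^+ m.+1 / (c * d * x r)) 0 (N r) (leq0n _).
  rewrite subn0 big_mkord => e; transitivity (thfact th (a * q ^+ m.+1 / (c * d * x r) / q ^+ N r) q (N r)).
    rewrite -e; apply: eq_bigr => i _; congr th; rewrite !exprS.
    by field; rewrite c0 d0 x0 q0 expq.
  congr (thfact th _ q _); rewrite !expfzDr // expr1z -exprnN -exprnP exprS.
  by field; rewrite c0 d0 x0 expq.
rewrite big_split prodfV /block_weight -/m /=.
have W0 : \prod_(r < n) fact (w * x r) (N r) != 0 by apply/prodf_neq0 => r _.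
rewrite !invfM.
set W := \prod_(r < n) fact (w * x r) _ in W0 *; set V := \prod_(r < n) fact _ _.
set Q := \prod_(r < n) \prod_(s < n) _.
by ring.
Qed.

Lemma block_term (j : {dffun forall r : 'I_n, 'I_(N r).+1}) :
    let k := (\sum_(r < n) j r)%N in let m := (\sum_(r < n) N r)%N in
    (forall r s (i : int), (r != s) || (0 < i) -> th (q ^ i * (x r / x s)) != 0) ->
    (forall r i, th (a * x r * q ^+ i) != 0) ->
    (forall r m, fact (b * c * d * x r / a) m != 0) ->
    (forall m, fact (a * q / c) m != 0) -> (forall m, fact (a * q / d) m != 0) ->
  block_weight * subset_term th block_point q a (b * q ^+ m) w c d [set: T] (segment j)
  = (fact b (m + k) *
      \prod_(r < n) fact (b * q ^ (m%:Z - (N r)%:Z) / (a * x r)) (N r - j r))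
    / ((\prod_(r < n) \prod_(s < n)
        fact (q ^ (1 + (j r)%:Z - (j s)%:Z) * x r / x s) (N r - j r))
       * \prod_(r < n) fact (a * x r * q) (N r + k))
    * (\prod_(r < n) (th (a * x r * q ^+ (j r + k)) / th (a * x r)
         * (fact (a * x r) k * (fact (c * x r) (j r) * fact (d * x r) (j r))
            / fact (b * c * d * x r / a) (j r)))
       * (fact (a ^+ 2 * q / (b * c * d)) k
          / (fact (a * q / c) k * fact (a * q / d) k
             * \prod_(r < n) \prod_(s < n) fact (q * x r / x s) (j r)))
       * (b / a) ^+ k
       * q ^+ (\sum_(r < n) \sum_(s < n | (r < s)%N) j r * j s)
       * \prod_(r < n) x r ^- j r).
Proof.
move=> k m thx0 thax bcdx0 ac0 ad0; have wx0 r i : fact (w * x r) i != 0 by rewrite -wxE.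
have -> : \prod_(r < n) (th (a * x r * q ^+ (j r + k)) / th (a * x r)
     * (fact (a * x r) k * (fact (c * x r) (j r) * fact (d * x r) (j r)) / fact (b * c * d * x r / a) (j r)))
   = \prod_(r < n) (th (a * x r * q ^+ (j r + k)) / th (a * x r)
     * (fact (a * x r) k * (fact (c * x r) (j r) * fact (d * x r) (j r)) / fact (w * x r) (j r))).
  by apply: eq_bigr => r _; rewrite wxE.
have le_jN r : (j r <= N r)%N by rewrite -ltnS ltn_ord.
have km : (k <= m)%N by apply: leq_sum => r _.
rewrite /subset_term card_blocks card_segment -/k -/m.
rewrite (@big_segmentC n N F 1 *%R j (fun r i => th (b * q ^+ m / (q * a * (x r * q ^+ i)))
   * th (w * (x r * q ^+ i)) / th (a * (x r * q ^+ i) * q ^+ k.+1))).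
rewrite (@big_segment n N F 1 *%R j (fun r i => th (c * (x r * q ^+ i)) * th (d * (x r * q ^+ i))
   / (x r * q ^+ i * th (a * (x r * q ^+ i) * q ^+ k)))).
rewrite (@big_segmentC n N F 1 *%R j (fun r i => \prod_(t in segment j)
   (th (q * (x r * q ^+ i) / block_point t) / th (x r * q ^+ i / block_point t)))).
have pairE : \prod_(r < n) \prod_(j r <= i < N r) \prod_(t in segment j)
   (th (q * (x r * q ^+ i) / block_point t) / th (x r * q ^+ i / block_point t))
  = (\prod_(r < n) \prod_(s < n) fact (q * x r / x s) (N r))
    / ((\prod_(r < n) \prod_(s < n) fact (q * x r / x s) (j r))
       * (\prod_(r < n) \prod_(s < n) fact (q ^ (1 + (j r)%:Z - (j s)%:Z) * x r / x s) (N r - j r))).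
  rewrite -big_split -prodfV -big_split /=; apply: eq_bigr => r _.
  rewrite -big_split -prodfV -big_split /=.
  transitivity (\prod_(j r <= i < N r) \prod_(s < n) \prod_(i' < j s)
     (th (q * (q ^+ i / q ^+ i' * (x r / x s))) / th (q ^+ i / q ^+ i' * (x r / x s)))).
    apply: eq_bigr => i _.
    rewrite (@big_segment n N F 1 *%R j (fun s i' => th (q * (x r * q ^+ i) / (x s * q ^+ i'))
       / th (x r * q ^+ i / (x s * q ^+ i')))).
    apply: eq_bigr => s _; apply: eq_bigr => i' _.
    by congr (th _ / th _); field; rewrite x0 expq.
  rewrite exchange_big /=; apply: eq_bigr => s _.
  rewrite (prod_block_pair q0 (u := x r / x s)) ?mulrA //.
    move=> i i' le_i lt_i'.
    have -> : q ^+ i / q ^+ i' = q ^ (i%:Z - i'%:Z) by rewrite expfzDr // -exprnN.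
    by apply: thx0; case: (eqVneq r s) => //= rs; rewrite -rs in lt_i'; lia.
  move=> i; have := thx0 r s i.+1%:Z; rewrite ltz_nat ltn0Sn orbT => /(_ isT).
  by rewrite -exprnP exprS mulrAC mulrA.
rewrite pairE.
have acE z : (forall m, fact (a * q / z) m != 0) -> \prod_(k <= i < m) th (a * q ^+ i.+1 / z)
     = fact (a * q / z) m / fact (a * q / z) k.
  move=> h; rewrite (thfact_split _ _ _ km) mulrAC divff // mul1r.
  by apply: eq_bigr => i _; congr th; rewrite exprS; ring.
have -> : \prod_(k <= i < m) (th (a * q ^+ i.+1 / c) * th (a * q ^+ i.+1 / d))
    = fact (a * q / c) m / fact (a * q / c) k * (fact (a * q / d) m / fact (a * q / d) k).
  by rewrite big_split /= (acE c ac0) (acE d ad0).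
have tailE : \prod_(r < n) \prod_(j r <= i < N r) (th (b * q ^+ m / (q * a * (x r * q ^+ i)))
   * th (w * (x r * q ^+ i)) / th (a * (x r * q ^+ i) * q ^+ k.+1))
  = \prod_(r < n) fact (b * q ^ (m%:Z - (N r)%:Z) / (a * x r)) (N r - j r)
    * (\prod_(r < n) fact (w * x r) (N r) / \prod_(r < n) fact (w * x r) (j r))
    / \prod_(r < n) \prod_(j r <= i < N r) th (a * x r * q ^+ i * q ^+ k.+1).
  rewrite -!prodfV -!big_split /=; apply: eq_bigr => r _; rewrite !big_split prodfV /=.
  congr (_ * _ / _); last by apply: eq_bigr => i _; rewrite !mulrA.
    have -> : b * q ^ (m%:Z - (N r)%:Z) / (a * x r) = b * q ^+ m / (a * x r) / q ^+ N r.
      by rewrite expfzDr // -exprnN -exprnP; field; rewrite a0 x0 expq.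
    rewrite -prod_rev_tail //; apply: eq_bigr => i _; congr th; rewrite exprS.
    by field; rewrite a0 x0 q0 expq.
  rewrite (thfact_split _ _ _ (le_jN r)) [RHS]mulrAC divff // mul1r.
  by apply: eq_bigr => i _; rewrite mulrA.
have headE : \prod_(r < n) \prod_(i < j r) (th (c * (x r * q ^+ i)) * th (d * (x r * q ^+ i))
   / (x r * q ^+ i * th (a * (x r * q ^+ i) * q ^+ k)))
  = \prod_(r < n) fact (c * x r) (j r) * \prod_(r < n) fact (d * x r) (j r)
    * \prod_(r < n) \prod_(i < j r) (x r * q ^+ i)^-1
    / \prod_(r < n) \prod_(i < j r) th (a * x r * q ^+ i * q ^+ k).
  rewrite -!prodfV -!big_split /=; apply: eq_bigr => r _; rewrite -!prodfV -!big_split /=.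
  by apply: eq_bigr => i _; rewrite !mulrA invfM; ring.
rewrite tailE headE.
set M2 := \prod_(r < n) \prod_(j r <= i < N r) _; set M1 := \prod_(r < n) \prod_(i < j r) th _.
have denomE : \prod_(r < n) (th (a * x r * q ^+ (j r + k)) / th (a * x r)
     * (fact (a * x r) k * (fact (c * x r) (j r) * fact (d * x r) (j r)) / fact (w * x r) (j r)))
   / \prod_(r < n) fact (a * x r * q) (N r + k)
  = \prod_(r < n) fact (c * x r) (j r) * \prod_(r < n) fact (d * x r) (j r)
    / \prod_(r < n) fact (w * x r) (j r) / (M1 * M2).
  have -> : (M1 * M2)^-1 = \prod_(r < n) (\prod_(i < j r) th (a * x r * q ^+ i * q ^+ k)
      * \prod_(j r <= i < N r) th (a * x r * q ^+ i * q ^+ k.+1))^-1.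
    by rewrite /M1 /M2 -big_split prodfV.
  rewrite -!prodfV -!big_split /=; apply: eq_bigr => r _.
  rewrite -(prod_block_denomV q0 k (le_jN r) (thax r)).
  move: (thfact th (a * x r * q) q _)^-1 (th (a * x r))^-1 (thfact th (w * x r) q _)^-1 => *.
  by ring.
have pointE := prod_block_points q0 x (fun r => j r : nat).
rewrite -/k in pointE.
set V := \prod_(r < n) fact _ (N r - j r); set Wj := \prod_(r < n) fact (w * x r) (j r).
set Y := \prod_(r < n) \prod_(i < j r) (x r * q ^+ i)^-1 in pointE *.
set X := \prod_(r < n) x r ^- j r in pointE *.
rewrite -/Wj in denomE.
have QN0 : \prod_(r < n) \prod_(s < n) fact (q * x r / x s) (N r) != 0.
  apply/prodf_neq0 => r _; apply/prodf_neq0 => s _; apply/prodf_neq0 => i _.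
  have := thx0 r s i.+1%:Z; rewrite ltz_nat ltn0Sn orbT => /(_ isT).
  by rewrite -exprnP exprS -!mulrA [q ^+ i * _]mulrC -!mulrA.
have WN0 : \prod_(r < n) fact (w * x r) (N r) != 0 by apply/prodf_neq0 => r _.
have Acm0 := ac0 m; have Adm0 := ad0 m.
rewrite /block_weight -/m thfactD.
have -> : a * q / w = a ^+ 2 * q / (b * c * d) by field; rewrite a0 b0 c0 d0.
have -> : w / (c * d) = b / a by field; rewrite a0 c0 d0.
set WN := \prod_(r < n) fact (w * x r) (N r) in WN0 *.
set QN := \prod_(r < n) \prod_(s < n) fact (q * x r / x s) (N r) in QN0 *.
set Acm := fact (a * q / c) m in Acm0 *; set Adm := fact (a * q / d) m in Adm0 *.
set G := \prod_(r < n) (_ / _ * _) in denomE *.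
set Dn := \prod_(r < n) fact (a * x r * q) _ in denomE *.
set Cj := \prod_(r < n) fact (c * x r) (j r) in denomE *.
set Dj := \prod_(r < n) fact (d * x r) (j r) in denomE *.
set Qj := \prod_(r < n) \prod_(s < n) fact (q * x r / x s) (j r).
set Bq := \prod_(r < n) \prod_(s < n) fact _ (N r - j r).
set Ek := fact (a ^+ 2 * _ / _) k; set Fk := fact (b * _) k; set Bm := fact b m.
set ack := fact (a * q / c) k; set adk := fact (a * q / d) k.
set ba := (b / a) ^+ k; set qC := q ^+ 'C(k, 2) in pointE *.
set qS := q ^+ (\sum_(r < n) _) in pointE *.
transitivity (Bm * Fk * V * Ek * ba / (Bq * ack * adk * Qj) * (G / Dn) * (qS * X)); last first.
  by rewrite !invfM; ring.
rewrite denomE -pointE !invfM.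
move: M1^-1 M2^-1 Wj^-1 Bq^-1 ack^-1 adk^-1 Qj^-1 => *.
by field; rewrite Acm0 Adm0 WN0 QN0.
Qed.

Lemma block_term_eq0 (f : F) (I : {set T}) : th 1 = 0 -> ~~ lower_closed I ->
  subset_term th block_point q a f w c d [set: T] I = 0.
Proof.
move=> th1; rewrite /lower_closed => /forallPn[r /forallPn[i /forallPn[i']]].
rewrite negb_imply => /andP[/eqP ii']; rewrite negb_imply => /andP[i'I iI].
rewrite /subset_term [X in _ * X = _](bigD1 (Tagged (fun r => 'I_(N r)) i)) /=; last by rewrite !inE iI.
rewrite [X in _ * (X * _) = _](bigD1 (Tagged (fun r => 'I_(N r)) i')) //= /block_point /=.
have -> : q * (x r * q ^+ i) / (x r * q ^+ i') = 1.
  by rewrite ii' exprS; field; rewrite x0 q0 expq.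
by rewrite th1 !mul0r mulr0.
Qed.
End BlockSum.

(** * Finite form of the Jacobi triple product *)

Section GaussBinomial.
Variables (F : fieldType) (p : F).

(** The Gauss binomial coefficients, defined by the recurrence of Pascal type so
    that they make sense for every [p]. *)
Fixpoint gauss (n i : nat) : F :=
  match n, i with
  | _, 0 => 1
  | 0, _.+1 => 0
  | n'.+1, i'.+1 => gauss n' i' + p ^+ i * gauss n' i
  end.

Lemma gauss_n0 n : gauss n 0 = 1. Proof. by case: n. Qed.

Lemma gauss_small n i : (n < i)%N -> gauss n i = 0.
Proof.
by elim: n i => [|n IHn] [|i] //= lt_ni; rewrite !IHn ?mulr0 ?addr0 // ltnW.
Qed.

(** The [q]-binomial theorem. *)
Lemma gauss_binomial n (y : F) :
  \prod_(j < n) (1 + y * p ^+ j) =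
  \sum_(i < n.+1) p ^+ 'C(i, 2) * gauss n i * y ^+ i.
Proof.
elim: n y => [|n IHn] y.
  by rewrite big_ord0 big_ord_recl big_ord0 /= !expr0 !mulr1 addr0.
rewrite big_ord_recl expr0 mulr1.
have -> : \prod_(i < n) (1 + y * p ^+ bump 0 i) = \prod_(i < n) (1 + y * p * p ^+ i).
  by apply: eq_bigr => i _; rewrite exprS mulrA.
rewrite IHn mulrDl mul1r [RHS]big_ord_recl /= !expr0 !mulr1.
have -> : \sum_(i < n.+1) p ^+ 'C(bump 0 i, 2) * (gauss n i + p ^+ i.+1 * gauss n i.+1) * y ^+ bump 0 i
  = \sum_(i < n.+1) p ^+ 'C(i, 2) * gauss n i * (y * p) ^+ i * y
    + \sum_(i < n.+1) p ^+ 'C(i.+1, 2) * gauss n i.+1 * (y * p) ^+ i.+1.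
  rewrite -big_split; apply: eq_bigr => i _ /=.
  by rewrite /bump /= add1n binS bin1 exprD !exprMn !exprS; ring.
rewrite -mulr_suml [y * _]mulrC addrCA [RHS]addrC; congr (_ + _); last exact: mulrC.
rewrite big_ord_recl big_ord_recr /= !expr0 (gauss_small (ltnSn n)) !mulr1 mulr0 mul0r addr0.
by rewrite mul1r gauss_n0.
Qed.

Definition pfact (m : nat) : F := \prod_(j < m) (1 - p ^+ j.+1).

Lemma pfactS m : pfact m.+1 = pfact m * (1 - p ^+ m.+1).
Proof. by rewrite /pfact big_ord_recr. Qed.

Lemma gauss_pfact n i : (i <= n)%N -> gauss n i * (pfact i * pfact (n - i)) = pfact n.
Proof.
elim: n i => [|n IHn] [|i] //= le_in.
- by rewrite /pfact !big_ord0 !mulr1.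
- by rewrite subn0 {1}/pfact big_ord0 !mul1r.
rewrite subSS mulrDl.
have e1 : gauss n i * (pfact i.+1 * pfact (n - i)) = pfact n * (1 - p ^+ i.+1).
  by rewrite -(IHn i le_in) pfactS; ring.
have e2 : p ^+ i.+1 * gauss n i.+1 * (pfact i.+1 * pfact (n - i))
    = pfact n * (p ^+ i.+1 * (1 - p ^+ (n - i))).
  have [lt_in|le_ni] := ltnP i n; last first.
    by rewrite gauss_small // (eqP (_ : n - i == 0)%N) ?subn_eq0 // expr0; ring.
  by rewrite -(IHn i.+1 lt_in) -(subnSK lt_in) (pfactS (n - i.+1)); ring.
rewrite e1 e2 -mulrDr pfactS; congr (_ * _).
have -> : p ^+ n.+1 = p ^+ i.+1 * p ^+ (n - i) by rewrite -exprD addSn subnKC.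
by ring.
Qed.
End GaussBinomial.

(** The Pluecker relation between the [2 x 2] minors of a [2 x 4] matrix. *)
Lemma wedge_plucker (V : comNzRingType) (e o : V) (e1 o1 e2 o2 e3 o3 : V) :
  (o * e1 - e * o1) * (o2 * e3 - e2 * o3) - (o * e2 - e * o2) * (o1 * e3 - e1 * o3)
  + (o * e3 - e * o3) * (o1 * e2 - e1 * o2) = 0.
Proof. by ring. Qed.

Lemma cancel_common_factor (F : fieldType) (g s t : F) : g != 0 ->
  g * s * (g * t) / g ^+ 2 = s * t.
Proof. by move=> g0; field. Qed.

Section JacobiExpansion.
Variables (F : fieldType) (p h : F).
Hypotheses (p0 : p != 0) (hE : h ^+ 2 = p).

Let h0 : h != 0. Proof. by apply: contra_neq p0 => h0; rewrite -hE h0 expr0n. Qed.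

(** The coefficient [p ^ (k (k - 1) / 2)] of the triple product is written with a
    square root [h] of [p], which keeps the exponents integral after the change
    of summation indices in [jacobi_term_pair]. *)
Definition jacobi_term (z : F) (k : int) : F := h ^ (k * k - k) * (- z) ^ k.

Lemma expr_p_h n : p ^+ n = h ^ (2 * n%:Z).
Proof. by rewrite -hE -exprM exprnP PoszM. Qed.

(** The [q]-binomial theorem with [2m] factors, shifted by [m]: up to a monomial
    the left-hand side is [prod_(j < 2m) (1 - z p^(j - m))]. *)
Lemma jacobi_expansion (z : F) (m : nat) : z != 0 ->
  \prod_(j < m) ((1 - z * p ^+ j) * (1 - p ^+ j.+1 / z))
  = \sum_(i < (m + m).+1) gauss p (m + m) i * jacobi_term z (i%:Z - m%:Z).
Proof.
move=> z0; have nz0 : - z != 0 by rewrite oppr_eq0.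
pose Q := \prod_(j < m) (- z / p ^+ j.+1).
have QE : Q = (- z) ^ m%:Z * h ^ (- (m%:Z * m%:Z + m%:Z)).
  rewrite /Q; elim: (m) => [|k IHk]; first by rewrite big_ord0 !expr0z mulr1.
  rewrite big_ord_recr /= IHk expr_p_h invr_expz mulrACA -expfzDr // -exprSzr.
  by congr (_ * h ^ _); lia.
have Q0 : Q != 0 by rewrite QE mulf_neq0 ?expfz_neq0.
apply: (mulIf Q0); rewrite mulr_suml.
set T := \prod_(j < m) _; have -> : T * Q = \prod_(j < m + m) (1 + (- z / p ^+ m) * p ^+ j).
  rewrite big_split_ord /= [RHS]mulrC /T big_split -mulrA; congr (_ * _).
    by apply: eq_bigr => j _; rewrite exprD; field; rewrite expf_neq0.
  rewrite [RHS](reindex_inj rev_ord_inj) -big_split; apply: eq_bigr => j _ /=.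
  have -> : p ^+ m = p ^+ (m - j.+1) * p ^+ j.+1 by rewrite -exprD subnK.
  by rewrite exprS; field; rewrite z0 p0 !expf_neq0.
rewrite gauss_binomial; apply: eq_bigr => i _; rewrite -[RHS]mulrA.
have -> : jacobi_term z (i%:Z - m%:Z) * Q = p ^+ 'C(i, 2) * (- z / p ^+ m) ^+ i.
  rewrite QE /jacobi_term [(- z) ^ m%:Z * _]mulrC mulrACA -!expfzDr //.
  rewrite exprMn exprVn -exprM !expr_p_h invr_expz mulrCA -expfzDr // mulrC.
  have -> : i%:Z - m%:Z + m%:Z = i%:Z by lia.
  congr (_ * h ^ _).
  by have := sqrn_bin2 i; lia.
by rewrite [RHS]mulrCA mulrA.
Qed.
Lemma jacobi_term_pair (x y : F) (k l : int) : x != 0 -> y != 0 ->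
  jacobi_term (x * y) k * jacobi_term (x / y) l
  = (-1) ^ (k + l) * (h ^ (k * k - k + (l * l - l)) * (x ^ (k + l) * y ^ (k - l))).
Proof.
move=> x0 y0; have m1 : (-1 : F) != 0 by rewrite oppr_eq0 oner_eq0.
have e1 : - (x * y) = -1 * x * y by ring.
have e2 : - (x / y) = -1 * x * y^-1 by ring.
rewrite /jacobi_term e1 e2 !expfzMl exprz_inv.
rewrite [(-1) ^ (k + l)]expfzDr // [x ^ (k + l)]expfzDr // [y ^ (k - l)]expfzDr //.
rewrite [h ^ (_ + (l * l - l))]expfzDr //.
by ring.
Qed.
End JacobiExpansion.

(** * Limits of complex sequences *)

From mathcomp Require Import complex.
From mathcomp Require Import all_classical all_reals all_analysis.
From mathcomp Require Import lra.

Import Order.TTheory GRing.Theory Num.Theory.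
Import numFieldNormedType.Exports.
Import Normc.
Local Open Scope classical_set_scope.
Local Open Scope complex_scope.
Local Open Scope ring_scope.

Section ComplexLimits.
Variable R : realType.
Local Notation C := R[i].
Implicit Types (z w l : C) (u : nat -> C).

Lemma normc_ge0 z : 0 <= normc z. Proof. by case: z => a b; exact: sqrtr_ge0. Qed.

Lemma normc_gt0 z : z != 0 -> 0 < normc z.
Proof.
by move=> z0; rewrite lt_neqAle normc_ge0 andbT eq_sym; apply: contra_neq z0 => /eq0_normc.
Qed.

Lemma normcX z k : normc (z ^+ k) = normc z ^+ k.
Proof. by elim: k => [|k IHk]; rewrite ?normc1 // !exprS normcM IHk. Qed.

Lemma normc_distC z w : normc (z - w) = normc (w - z).
Proof. by rewrite -normcN opprB. Qed.

Lemma normc_prod (I : Type) (s : seq I) (P : pred I) (f : I -> C) :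
  normc (\prod_(i <- s | P i) f i) = \prod_(i <- s | P i) normc (f i).
Proof. by apply: (big_morph _ (@normcM R)); exact: normc1. Qed.

Lemma normc_sum (I : Type) (s : seq I) (P : pred I) (f : I -> C) :
  normc (\sum_(i <- s | P i) f i) <= \sum_(i <- s | P i) normc (f i).
Proof.
elim/big_rec2: _ => [|i y x _ le_xy]; first by rewrite normc0.
by apply: le_trans (le_normcD _ _) _; rewrite lerD2l.
Qed.

Lemma normc_ge_sub z w : normc z - normc w <= normc (z - w).
Proof. by rewrite lerBlDr; apply: le_trans (le_normcD _ _); rewrite subrK. Qed.

(** Convergence for the topology of the modulus; the definition keeps the
    [R[i]^o] annotations out of the statements below. *)
Definition ccvg (T : Type) (F : set_system T) (f : T -> C) (l : C) : Prop :=
  (fun x => f x : R[i]^o) @ F --> (l : R[i]^o).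

Lemma ccvgP (T : Type) (F : set_system T) {FF : Filter F} (f : T -> C) l :
  ccvg F f l <-> ((fun x => normc (f x - l)) @ F --> (0 : R)).
Proof.
split=> /cvgrPdist_lt h; apply/cvgrPdist_lt => e e0.
  have e1 : (0 : C) < e%:C by rewrite ltcR.
  apply: filterS (h _ e1) => m; rewrite sub0r normrN (ger0_norm (normc_ge0 _)).
  by rewrite normc_distC -ltcR.
have eE : (complex.Re e)%:C = e by apply: RRe_real; exact: gtr0_real.
have e1 : (0 : R) < complex.Re e by rewrite -ltcR eE.
apply: filterS (h _ e1) => m; rewrite sub0r normrN (ger0_norm (normc_ge0 _)).
by rewrite normc_distC -ltcR eE.
Qed.

Lemma ccvg_unique (F : set_system nat) (FF : ProperFilter F) u l l' :
  ccvg F u l -> ccvg F u l' -> l = l'.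
Proof. by move=> /cvg_lim <- // /cvg_lim <-. Qed.

Section CcvgTheory.
Variables (T : Type) (F : set_system T).
Context {FF : Filter F}.
Implicit Types (f g : T -> C).

Lemma ccvg_cst l : ccvg F (fun=> l) l. Proof. exact: cvg_cst. Qed.

Lemma ccvgD f g l l' : ccvg F f l -> ccvg F g l' -> ccvg F (fun x => f x + g x) (l + l').
Proof. exact: (@cvgD R[i] R[i]^o T F FF f g l l'). Qed.

Lemma ccvgB f g l l' : ccvg F f l -> ccvg F g l' -> ccvg F (fun x => f x - g x) (l - l').
Proof. exact: (@cvgB R[i] R[i]^o T F FF f g l l'). Qed.

Lemma ccvgM f g l l' : ccvg F f l -> ccvg F g l' -> ccvg F (fun x => f x * g x) (l * l').
Proof. exact: (@cvgM R[i] T F FF f g l l'). Qed.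

Lemma ccvgV f l : l != 0 -> ccvg F f l -> ccvg F (fun x => (f x)^-1) l^-1.
Proof. exact: (@cvgV R[i] T F FF f l). Qed.

Lemma ccvg_prod (I : Type) (s : seq I) (P : pred I) (f : T -> I -> C) (l : I -> C) :
  (forall i, P i -> ccvg F (f^~ i) (l i)) ->
  ccvg F (fun x => \prod_(i <- s | P i) f x i) (\prod_(i <- s | P i) l i).
Proof.
move=> fl; elim: s => [|i s IHs].
  by rewrite big_nil; under eq_fun do rewrite big_nil; exact: ccvg_cst.
rewrite big_cons; under eq_fun do rewrite big_cons.
by case: ifP => [Pi|_]; [exact: (ccvgM (fl i Pi) IHs) | exact: IHs].
Qed.

Lemma ccvg_sum (I : Type) (s : seq I) (P : pred I) (f : T -> I -> C) (l : I -> C) :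
  (forall i, P i -> ccvg F (f^~ i) (l i)) ->
  ccvg F (fun x => \sum_(i <- s | P i) f x i) (\sum_(i <- s | P i) l i).
Proof.
move=> fl; elim: s => [|i s IHs].
  by rewrite big_nil; under eq_fun do rewrite big_nil; exact: ccvg_cst.
rewrite big_cons; under eq_fun do rewrite big_cons.
by case: ifP => [Pi|_]; [exact: (ccvgD (fl i Pi) IHs) | exact: IHs].
Qed.
End CcvgTheory.

Lemma ccvg_eventually u l (e : R) : ccvg \oo u l -> 0 < e ->
  exists M, forall m, (M <= m)%N -> normc (u m - l) < e.
Proof.
move=> /ccvgP/cvgrPdist_lt ul e0; have [M _ uM] := ul e e0.
by exists M => m /uM /=; rewrite sub0r normrN (ger0_norm (normc_ge0 _)).
Qed.

Lemma geometric_bound (r K : R) m k : 0 <= r -> r < 1 -> 0 <= K ->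
  \sum_(j < k) K * r ^+ (m + j) <= K * r ^+ m / (1 - r).
Proof.
move=> r0 r1 K0.
have -> : \sum_(j < k) K * r ^+ (m + j) = K * r ^+ m * \sum_(j < k) r ^+ j.
  by rewrite mulr_sumr; apply: eq_bigr => j _; rewrite exprD mulrA.
have d0 : 0 < 1 - r by rewrite subr_gt0.
rewrite ler_wpM2l ?mulr_ge0 ?exprn_ge0 // -[_^-1]mul1r ler_pdivlMr // mulrC.
have -> : (1 - r) * \sum_(j < k) r ^+ j = 1 - r ^+ k.
  by rewrite -[RHS]opprB subrX1 -mulNr opprB.
by rewrite lerBlDr lerDl exprn_ge0.
Qed.


Lemma real_geometric_cvg (v : nat -> R) (K r : R) : 0 <= r -> r < 1 ->
  (forall m, `|v m.+1 - v m| <= K * r ^+ m) -> cvg (v @ \oo).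
Proof.
move=> r0 r1 vK; have r1' : `|r| < 1 by rewrite ger0_norm.
have vE : v = (fun n => v 0%N + series (telescope v) n).
  by apply/funext => n; rewrite [LHS](eq_sum_telescope v n).
rewrite vE; apply: is_cvgD; first exact: is_cvg_cst.
apply: normed_cvg; apply: (@series_le_cvg _ _ (geometric K r)).
- by move=> n /=.
- by move=> n; apply: le_trans (vK n).
- by move=> n /=; exact: vK.
- exact: is_cvg_geometric_series.
Qed.

Lemma normc_le_ReIm z : normc z <= `|complex.Re z| + `|complex.Im z|.
Proof.
case: z => x y /=; rewrite -(@ger0_norm _ (`|x| + `|y|)) ?addr_ge0 //.
rewrite -sqrtr_sqr ler_wsqrtr // sqrrD !real_normK ?num_real //.
by rewrite lerD2r lerDl mulrn_wge0 ?mulr_ge0.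
Qed.

Lemma normc_ge_Re z : `|complex.Re z| <= normc z.
Proof.
by case: z => x y /=; rewrite -sqrtr_sqr ler_wsqrtr // lerDl sqr_ge0.
Qed.

Lemma normc_ge_Im z : `|complex.Im z| <= normc z.
Proof.
by case: z => x y /=; rewrite -sqrtr_sqr ler_wsqrtr // lerDr sqr_ge0.
Qed.

(** Completeness of the complex numbers, in the form in which it is used: steps
    that decay geometrically, with an explicit rate of convergence. *)
Lemma geometric_cvg (u : nat -> C) (K r : R) : 0 <= r -> r < 1 ->
    (forall m, normc (u m.+1 - u m) <= K * r ^+ m) ->
  exists l : C, ccvg \oo u l /\
    forall m, normc (u m - l) <= K * r ^+ m / (1 - r).
Proof.
move=> r0 r1 uK.
have K0 : 0 <= K by have := uK 0%N; rewrite expr0 mulr1; apply: le_trans (normc_ge0 _).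
have cRe : cvg ((fun m => complex.Re (u m)) @ \oo).
  apply: (real_geometric_cvg r0 r1) => m; apply: le_trans (uK m).
  by apply: le_trans (normc_ge_Re _); case: (u _) (u _) => ? ? [].
have cIm : cvg ((fun m => complex.Im (u m)) @ \oo).
  apply: (real_geometric_cvg r0 r1) => m; apply: le_trans (uK m).
  by apply: le_trans (normc_ge_Im _); case: (u _) (u _) => ? ? [].
pose a := lim ((fun m => complex.Re (u m)) @ \oo).
pose b := lim ((fun m => complex.Im (u m)) @ \oo).
have ul : (fun m => normc (u m - (a +i* b))) @ \oo --> (0 : R).
  apply: (@squeeze_cvgr _ _ _ _ (fun=> 0) (fun m => `|complex.Re (u m) - a| + `|complex.Im (u m) - b|)).
  - near=> m; rewrite normc_ge0 /=; apply: le_trans (normc_le_ReIm _) _.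
    by case: (u m).
  - exact: cvg_cst.
  rewrite -[X in _ --> X]addr0; apply: cvgD; apply/norm_cvg0P.
    by apply/subr_cvg0.
  by apply/subr_cvg0.
exists (a +i* b); split; first exact/ccvgP.
move=> m; apply/ler_addgt0Pr => e e0.
have [M uM] := ccvg_eventually ((ccvgP _ _).2 ul) e0.
have /ltW h := uM (m + M)%N (leq_addl _ _).
have -> : u m - (a +i* b) = (u m - u (m + M)%N) + (u (m + M)%N - (a +i* b)).
  by rewrite addrA subrK.
apply: le_trans (le_normcD _ _) _; apply: lerD h.
apply: le_trans (geometric_bound m M r0 r1 K0).
rewrite normc_distC; elim: (M) => [|k IHk].
  by rewrite addn0 subrr normc0 big_ord0.
rewrite big_ord_recr /= addnS -[u (m + k).+1](subrK (u (m + k)%N)) -addrA addrC.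
by apply: le_trans (le_normcD _ _) _; apply: lerD.
Unshelve. all: by end_near. Qed.

End ComplexLimits.

Arguments ccvg_cst {R T F FF} l.
Arguments ccvgD {R T F FF f g l l'} _ _.
Arguments ccvgB {R T F FF f g l l'} _ _.
Arguments ccvgM {R T F FF f g l l'} _ _.
Arguments ccvgV {R T F FF f l} _ _.

Section Tannery.
Variables (R : realType) (I : eqType).
Local Notation C := R[i].

Lemma sum_uniq_subset (V : nmodType) (s t : seq I) (f : I -> V) :
    uniq s -> uniq t -> {subset s <= t} ->
  \sum_(i <- t) f i = \sum_(i <- s) f i + \sum_(i <- [seq i <- t | i \notin s]) f i.
Proof.
move=> us ut st; rewrite (bigID (mem s)) /= big_filter; congr (_ + _).
rewrite -big_filter; apply: perm_big; apply: uniq_perm => //; first exact: filter_uniq.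
by move=> i; rewrite mem_filter /=; case: (boolP (i \in s)) => // /st ->.
Qed.

(** Dominated convergence for sums over finite sets that exhaust an index set.
    The two families of finite sets are independent of each other, so that the
    lemma also rearranges the limit sum. *)
Lemma tannery (W : I -> R) (b : R) (A B : nat -> seq I) (f : nat -> I -> C) (g : I -> C) :
    (forall i, 0 <= W i) ->
    (forall s, uniq s -> \sum_(i <- s) W i <= b) ->
    (forall m, uniq (A m)) -> (forall m, uniq (B m)) ->
    (forall i, exists M, forall m, (M <= m)%N -> (i \in A m) && (i \in B m)) ->
    (forall m i, normc (f m i) <= W i) -> (forall i, normc (g i) <= W i) ->
    (forall i, ccvg \oo (f^~ i) (g i)) ->
  ccvg \oo (fun m => \sum_(i <- A m) f m i - \sum_(i <- B m) g i) 0.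
Proof.
move=> W0 Wb uA uB AB fW gW fg.
pose S := [set w : R | exists2 s : seq I, uniq s & w = \sum_(i <- s) W i].
have hS : has_sup S.
  split; first by exists 0, [::]; rewrite ?big_nil.
  by exists b => w [s us ->]; exact: Wb.
apply/ccvgP/cvgrPdist_lt => e e0.
have e3 : 0 < e / 3 by rewrite divr_gt0.
have [_ [s0 us0 ->] s0_sup] := sup_adherent e3 hS.
have tail (h : I -> C) t : (forall i, normc (h i) <= W i) -> uniq t -> {subset s0 <= t} ->
    normc (\sum_(i <- [seq i <- t | i \notin s0]) h i) < e / 3.
  move=> hW ut s0t; apply: le_lt_trans (normc_sum _ _ _) _.
  apply: (@le_lt_trans _ _ (\sum_(i <- [seq i <- t | i \notin s0]) W i)).
    by apply: ler_sum => i _; exact: hW.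
  have := @sum_uniq_subset _ s0 t W us0 ut s0t.
  have : \sum_(i <- t) W i <= sup S by apply: sup_upper_bound => //; exists t.
  lra.
have [M s0M] : exists M, forall m, (M <= m)%N -> {subset s0 <= A m} /\ {subset s0 <= B m}.
  elim: (s0) => [|i s [M sM]]; first by exists 0%N.
  have [M' iM'] := AB i; exists (maxn M M') => m.
  rewrite geq_max => /andP[/sM[sA sB] /iM' /andP[iA iB]].
  by split=> k; rewrite inE => /predU1P[->//|]; [exact: sA | exact: sB].
have /ccvg_eventually/(_ e3)[M' fgM] : ccvg \oo
    (fun m => \sum_(i <- s0) f m i) (\sum_(i <- s0) g i).
  by apply: ccvg_sum => i _; exact: fg.
exists (maxn M M') => // m /=; rewrite geq_max => /andP[/s0M[sA sB] /fgM fgm].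
rewrite sub0r normrN (ger0_norm (normc_ge0 _)) subr0.
rewrite (sum_uniq_subset _ us0 (uA m) sA) (sum_uniq_subset _ us0 (uB m) sB).
have tA := tail (f m) _ (fW m) (uA m) sA; have tB := tail g _ gW (uB m) sB.
move: (\sum_(i <- [seq i <- A m | _]) _) (\sum_(i <- [seq i <- B m | _]) _) tA tB => t t' tA tB.
move: (\sum_(i <- s0) f m i) (\sum_(i <- s0) g i) fgm => a a' fgm.
have -> : a + t - (a' + t') = (a - a') + (t - t') by ring.
apply: le_lt_trans (le_normcD _ _) _.
have := le_normcD t (- t'); rewrite normcN; lra.
Qed.
End Tannery.

(** * Infinite products *)

Section InfiniteProduct.
Variables (R : realType) (u : nat -> R[i]) (K r : R).
Hypotheses (r0 : 0 <= r) (r1 : r < 1).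
Hypothesis uK : forall j, normc (u j) <= K * r ^+ j.

Let K0 : 0 <= K.
Proof. by have := uK 0%N; rewrite expr0 mulr1; apply: le_trans (normc_ge0 _). Qed.

(** From [1 + x <= exp x] and the geometric series. *)
Lemma tail_product_le m k :
  normc (\prod_(j < k) (1 - u (m + j)%N)) <= expR (K / (1 - r)).
Proof.
rewrite normc_prod; apply: (@le_trans _ _ (\prod_(j < k) expR (K * r ^+ j))).
  apply: ler_prod => j _; rewrite normc_ge0 /=.
  apply: le_trans (expR_ge1Dx _); apply: le_trans (le_normcD _ _) _.
  rewrite normc1 normcN lerD2l; apply: le_trans (uK _) _.
  by rewrite ler_wpM2l // exprD ler_piMl ?exprn_ge0 // exprn_ile1 // ltW.
rewrite -expR_sum ler_expR.
by have := geometric_bound 0 k r0 r1 K0; rewrite expr0 mulr1.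
Qed.

Lemma infinite_product_cvg :
  exists l : R[i], ccvg \oo (fun m => \prod_(j < m) (1 - u j)) l /\
  forall m, normc (\prod_(j < m) (1 - u j) - l)
     <= expR (K / (1 - r)) * K / (1 - r) * r ^+ m.
Proof.
have [m|l [ul le_l]] := @geometric_cvg R (fun m => \prod_(j < m) (1 - u j))
    (expR (K / (1 - r)) * K) r r0 r1.
  rewrite big_ord_recr /= mulrBr mulr1 addrAC subrr add0r normcN normcM -mulrA.
  apply: ler_pM; rewrite ?normc_ge0 //.
  exact: (tail_product_le 0).
by exists l; split => // m; rewrite mulrAC.
Qed.

(** Beyond some rank the defects sum to at most 1/2, so the tail products have
    modulus at least 1/2; the finitely many earlier partial products divide a
    nonzero one with a bounded quotient. *)
Lemma infinite_product_lbound : (forall j, 1 - u j != 0) ->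
  exists2 d : R, 0 < d & forall m, d <= normc (\prod_(j < m) (1 - u j)).
Proof.
move=> u_neq1; have d1 : 0 < 1 - r by rewrite subr_gt0.
have [J tailJ] : exists J, forall k, \sum_(j < k) K * r ^+ (J + j) <= 2^-1.
  have : (fun m => K / (1 - r) * r ^+ m) @ \oo --> (0 : R).
    rewrite -[X in _ --> X](mulr0 (K / (1 - r))); apply: cvgM; first exact: cvg_cst.
    by apply: cvg_expr; rewrite ger0_norm.
  move=> /cvgrPdist_lt/(_ 2^-1) [|J _ Jr]; first by rewrite invr_gt0.
  exists J => k; apply: le_trans (geometric_bound J k r0 r1 K0) _.
  have := Jr J (leqnn J); rewrite /= sub0r normrN => /ltW.
  by apply: le_trans; rewrite mulrAC ler_norm.
have half k : 1 - \sum_(j < k) K * r ^+ (J + j) <= normc (\prod_(j < k) (1 - u (J + j)%N)).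
  elim: k => [|k IHk]; first by rewrite !big_ord0 subr0 normc1.
  rewrite !big_ord_recr /= normcM.
  have a0 : 0 <= K * r ^+ (J + k) by rewrite mulr_ge0 ?exprn_ge0.
  have s0 : 0 <= \sum_(j < k) K * r ^+ (J + j).
    by apply: sumr_ge0 => j _; rewrite mulr_ge0 ?exprn_ge0.
  have := tailJ k.+1; rewrite big_ord_recr /= => tJ.
  have h1 : 1 - K * r ^+ (J + k) <= normc (1 - u (J + k)%N).
    by apply: le_trans (normc_ge_sub _ _); rewrite normc1 lerD2l lerN2.
  move: IHk h1 a0 s0 tJ; move: (\sum_(j < k) _) (K * _) (normc _) (normc _) => S A P Q.
  nra.
have half' k : 2^-1 <= normc (\prod_(j < k) (1 - u (J + j)%N)).
  by apply: le_trans (half k); have := tailJ k; lra.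
pose B := expR (K / (1 - r)).
have B0 : 0 < B by exact: expR_gt0.
pose PJ := normc (\prod_(j < J) (1 - u j)).
have PJ0 : 0 < PJ by apply: normc_gt0; apply/prodf_neq0.
have B1 : 1 <= B by rewrite -expR0 ler_expR divr_ge0 // ltW.
exists (PJ / (2 * B)); first by rewrite divr_gt0 // mulr_gt0.
move=> m; rewrite ler_pdivrMr ?mulr_gt0 //.
have [le_Jm|lt_mJ] := leqP J m.
  rewrite -(subnKC le_Jm) big_split_ord /= normcM -/PJ -mulrA ler_peMr ?(ltW PJ0) //.
  by have := half' (m - J)%N; move: (normc _) => X; nra.
rewrite /PJ -(subnKC (ltnW lt_mJ)) big_split_ord /= normcM ler_wpM2l ?normc_ge0 //.
apply: le_trans (tail_product_le m (J - m)) _; rewrite -/B; lra.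
Qed.

Lemma infinite_product_neq0 (l : R[i]) : (forall j, 1 - u j != 0) ->
  ccvg \oo (fun m => \prod_(j < m) (1 - u j)) l -> l != 0.
Proof.
move=> /infinite_product_lbound[d d0 le_d] /ccvg_eventually/(_ d0)[M /(_ M (leqnn M)) PM].
by apply/eqP => l0; move: PM; rewrite l0 subr0 ltNge le_d.
Qed.
End InfiniteProduct.

(** * Convergence, inversion, zeros and continuity of theta *)

Section ThetaConvergence.
Variables (R : realType) (p : R[i]).
Hypothesis p_lt1 : normc p < 1.
Local Notation C := R[i].
Local Notation r := (normc p).
Let r0 : 0 <= r := normc_ge0 p.
Implicit Types z : C.

Definition theta_prod (z : C) (m : nat) : C :=
  \prod_(j < m) ((1 - z * p ^+ j) * (1 - p ^+ j.+1 / z)).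

(** The pair of factors of index [j] in theta is [1 - theta_defect z j], and the
    defects decay geometrically. *)
Definition theta_defect (z : C) (j : nat) : C :=
  z * p ^+ j + p ^+ j.+1 / z - z * p ^+ j * (p ^+ j.+1 / z).

Lemma theta_prodE z m : theta_prod z m = \prod_(j < m) (1 - theta_defect z j).
Proof. by apply: eq_bigr => j _; rewrite /theta_defect; ring. Qed.

Lemma theta_defect_le (M : R) z j : z != 0 -> normc z <= M -> normc z^-1 <= M ->
  normc (theta_defect z j) <= (M + M + 1) * r ^+ j.
Proof.
move=> z0 zM zVM; rewrite /theta_defect.
have rj0 : 0 <= r ^+ j by rewrite exprn_ge0.
have rj1 : r ^+ j.+1 <= r ^+ j by rewrite exprS ler_piMl // ltW.
have rj1' : r ^+ j.+1 <= 1 by rewrite exprn_ile1 // ltW.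
rewrite mulrDl mul1r mulrDl; apply: le_trans (le_normcD _ _) _.
rewrite normcN; apply: lerD.
  apply: le_trans (le_normcD _ _) _; rewrite !normcM !normcX; apply: lerD.
    by rewrite ler_wpM2r.
  by rewrite mulrC ler_pM ?normc_ge0 ?exprn_ge0.
have -> : z * p ^+ j * (p ^+ j.+1 / z) = p ^+ j * p ^+ j.+1 by field.
by rewrite normcM !normcX ler_piMr.
Qed.

(** The rate of convergence depends on [z] only through a bound on [|z|] and
    [1/|z|]; this local uniformity gives [theta_continuous]. *)
Lemma theta_cvg_bound (M : R) z : z != 0 -> normc z <= M -> normc z^-1 <= M ->
  ccvg \oo (theta_prod z) (theta p z) /\
  forall m, normc (theta_prod z m - theta p z) <=
    expR ((M + M + 1) / (1 - r)) * (M + M + 1) / (1 - r) * r ^+ m.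
Proof.
move=> z0 zM zVM.
have [l [zl le_l]] := infinite_product_cvg r0 p_lt1 (fun j => theta_defect_le j z0 zM zVM).
have prodE : theta_prod z = (fun m => \prod_(j < m) (1 - theta_defect z j)).
  by apply/funext => m; rewrite theta_prodE.
have thl : theta p z = l.
  by apply: (@cvg_lim R[i]^o) => //; rewrite -[X in X @ _]/(theta_prod z) prodE.
by rewrite thl prodE.
Qed.

Lemma theta_cvg z : z != 0 ->
  ccvg \oo (theta_prod z) (theta p z).
Proof.
move=> z0; apply: (@theta_cvg_bound (Num.max (normc z) (normc z^-1)) z z0 _ _).1.
  by rewrite le_max lexx.
by rewrite le_max lexx orbT.
Qed.

(** A convergent infinite product without a vanishing factor does not vanish. *)
Lemma theta_eq0 z : z != 0 -> theta p z = 0 ->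
  exists j, z * p ^+ j = 1 \/ p ^+ j.+1 = z.
Proof.
move=> z0 thz; apply: contrapT => /forallNP noroot.
pose M := Num.max (normc z) (normc z^-1).
have zM : normc z <= M by rewrite le_max lexx.
have zVM : normc z^-1 <= M by rewrite le_max lexx orbT.
have := @infinite_product_neq0 R (theta_defect z) _ r r0 p_lt1
  (fun j => theta_defect_le j z0 zM zVM) (theta p z).
rewrite thz eqxx; have {}noroot j : 1 - theta_defect z j != 0.
  have -> : 1 - theta_defect z j = (1 - z * p ^+ j) * (1 - p ^+ j.+1 / z).
    by rewrite /theta_defect; ring.
  have /not_orP[h1 h2] := noroot j.
  rewrite mulf_neq0 // subr_eq0; apply/eqP => e; first by apply: h1.
  by apply: h2; rewrite -[LHS](divfK z0) -e mul1r.
move=> /(_ noroot) h; suff: false by []; apply: h.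
have := theta_cvg z0; rewrite thz.
have -> : theta_prod z = (fun m => \prod_(j < m) (1 - theta_defect z j)) => //.
by apply/funext => m; rewrite theta_prodE.
Qed.

Lemma ccvg_expr : ccvg \oo (fun m => p ^+ m) 0.
Proof.
apply/ccvgP; under eq_fun => m do rewrite subr0 normcX.
by apply: cvg_expr; rewrite ger0_norm.
Qed.

Lemma theta1 : theta p 1 = 0.
Proof.
apply: (@ccvg_unique R \oo _ (theta_prod 1)); first exact/theta_cvg/oner_neq0.
apply/ccvgP; apply: cvg_near_cst; exists 1%N => // m /= m1.
rewrite subr0; case: m m1 => // m _.
by rewrite /theta_prod big_ord_recl expr0 mulr1 subrr !mul0r normc0.
Qed.

(** Passing from [z] to [1 / z] exchanges the two kinds of factors up to a shift
    of the index, so all but the extreme factors cancel. *)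
Lemma theta_prodV z m : z != 0 -> z != 1 ->
  theta_prod z^-1 m * (1 - p ^+ m / z) = - z^-1 * theta_prod z m * (1 - z * p ^+ m).
Proof.
move=> z0 z1; elim: m => [|m IHm].
  by rewrite /theta_prod !big_ord0 expr0; field.
rewrite /theta_prod !big_ord_recr /= -!/(theta_prod _ m) invrK.
have -> : z^-1 * p ^+ m = p ^+ m / z by rewrite mulrC.
rewrite mulrA IHm; rewrite [p ^+ m.+1 * z]mulrC; ring.
Qed.

Lemma thetaV z : z != 0 -> theta p z^-1 = - z^-1 * theta p z.
Proof.
move=> z0; have [->|z1] := eqVneq z 1; first by rewrite invr1 theta1 mulr0.
have zV0 : z^-1 != 0 by rewrite invr_eq0.
have lhs : ccvg \oo (fun m => theta_prod z^-1 m * (1 - p ^+ m / z)) (theta p z^-1 * (1 - 0 / z)).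
  exact: (ccvgM (theta_cvg zV0) (ccvgB (ccvg_cst 1) (ccvgM ccvg_expr (ccvg_cst _)))).
have rhs : ccvg \oo (fun m => - z^-1 * theta_prod z m * (1 - z * p ^+ m))
    (- z^-1 * theta p z * (1 - z * 0)).
  exact: (ccvgM (ccvgM (ccvg_cst _) (theta_cvg z0))
    (ccvgB (ccvg_cst 1) (ccvgM (ccvg_cst _) ccvg_expr))).
have e : (fun m => theta_prod z^-1 m * (1 - p ^+ m / z)) =
    (fun m => - z^-1 * theta_prod z m * (1 - z * p ^+ m)).
  by apply/funext => m; rewrite theta_prodV.
rewrite mul0r mulr0 !subr0 !mulr1 in lhs rhs.
by apply: (ccvg_unique _ lhs); rewrite e.
Qed.

Lemma theta_prod_continuous m (z0 : R[i]^o) : z0 != 0 ->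
  ccvg (nbhs z0) (theta_prod ^~ m) (theta_prod z0 m).
Proof.
move=> z00; apply: ccvg_prod => j _.
have id_cvg : ccvg (nbhs z0) (fun z => z) z0 by exact: cvg_id.
exact: (ccvgM (ccvgB (ccvg_cst 1) (ccvgM id_cvg (ccvg_cst _)))
  (ccvgB (ccvg_cst 1) (ccvgM (ccvg_cst _) (ccvgV z00 id_cvg)))).
Qed.

Lemma theta_continuous (z0 : R[i]^o) : z0 != 0 ->
  ccvg (nbhs z0) (theta p) (theta p z0).
Proof.
move=> z00; have n0 := normc_gt0 z00.
pose M := 2 * Num.max (normc z0) (normc z0^-1).
have le_M1 : 2 * normc z0 <= M by rewrite ler_wpM2l // le_max lexx.
have le_M2 : 2 * normc z0^-1 <= M by rewrite ler_wpM2l // le_max lexx orbT.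
pose K := expR ((M + M + 1) / (1 - r)) * (M + M + 1) / (1 - r).
have Kr0 : (fun m => K * r ^+ m) @ \oo --> (0 : R).
  rewrite -[X in _ --> X](mulr0 K); apply: cvgM; first exact: cvg_cst.
  by apply: cvg_expr; rewrite ger0_norm.
have id_cvg : ccvg (nbhs z0) (fun z => z) z0 by exact: cvg_id.
have z_near : (fun z : C => normc (z - z0)) @ nbhs z0 --> (0 : R).
  exact: (ccvgP _ _).1 id_cvg.
apply/ccvgP/cvgrPdist_lt => e e0.
have e3 : 0 < e / 3 by rewrite divr_gt0.
have /cvgrPdist_lt/(_ _ e3)[m _ /(_ m (leqnn m))] := Kr0.
rewrite /= sub0r normrN => /(le_lt_trans (ler_norm _)) Km.
have /ccvgP/cvgrPdist_lt/(_ _ e3) nearm := @theta_prod_continuous m z0 z00.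
have n2 : 0 < normc z0 / 2 by rewrite divr_gt0.
have /cvgrPdist_lt/(_ _ n2) nearz := z_near.
near=> z; rewrite sub0r normrN (ger0_norm (normc_ge0 _)).
have zz0 : normc (z - z0) < normc z0 / 2.
  by rewrite -[normc _](ger0_norm (normc_ge0 _)) -normrN -sub0r; near: z.
have pz : normc (theta_prod z m - theta_prod z0 m) < e / 3.
  by rewrite -[normc _](ger0_norm (normc_ge0 _)) -normrN -sub0r; near: z.
have z_ge : normc z0 / 2 <= normc z.
  by have := normc_ge_sub z0 z; rewrite normc_distC; move: zz0; lra.
have z_le : normc z <= 2 * normc z0.
  by have := normc_ge_sub z z0; move: zz0; lra.
have zn0 : z != 0 by apply: contraTneq z_ge => ->; rewrite normc0 -ltNge.
have zM : normc z <= M by exact: le_trans le_M1.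
have zVM : normc z^-1 <= M.
  apply: le_trans le_M2; rewrite !normcV.
  by rewrite -[2]invrK -invfM lef_pV2 ?posrE ?mulr_gt0 ?invr_gt0 ?normc_gt0 // mulrC.
have [_ /(_ m) bz] := theta_cvg_bound zn0 zM zVM.
have z0M : normc z0 <= M by apply: le_trans le_M1; lra.
have z0VM : normc z0^-1 <= M.
  by apply: le_trans le_M2; have := normc_ge0 z0^-1; lra.
have [_ /(_ m) bz0] := theta_cvg_bound z00 z0M z0VM.
have -> : theta p z - theta p z0 = (theta_prod z m - theta_prod z0 m)
   + ((theta_prod z0 m - theta p z0) - (theta_prod z m - theta p z)) by ring.
apply: le_lt_trans (le_normcD _ _) _.
have := le_normcD (theta_prod z0 m - theta p z0) (- (theta_prod z m - theta p z)).
rewrite normcN; rewrite -/K in bz bz0; lra.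
Unshelve. all: by end_near. Qed.
End ThetaConvergence.

(** * The three-term relation of theta *)

Section ThetaSeries.
Variables (R : realType) (p h : R[i]).
Hypotheses (p0 : p != 0) (hE : h ^+ 2 = p) (p_lt1 : normc p < 1).
Local Notation C := R[i].
Implicit Types (z x y : C) (k l : int).
Local Notation jterm := (jacobi_term h).

Let h0 : h != 0. Proof. by apply: contra_neq p0 => h0; rewrite -hE h0 expr0n. Qed.

Lemma theta_prod_expand z m : z != 0 ->
  theta_prod p z m = \sum_(i < (m + m).+1) gauss p (m + m) i * jterm z (i%:Z - m%:Z).
Proof. exact: jacobi_expansion. Qed.

Definition int_range (m : nat) : seq int :=
  [seq i%:Z - m%:Z | i <- index_iota 0 (m + m).+1].

Lemma mem_int_range m k : (k \in int_range m) = (`|k| <= m)%N.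
Proof.
apply/mapP/idP => [[i ii ->]|le_km].
  by move: ii; rewrite mem_index_iota; lia.
by exists `|(k + m%:Z)%R|%N; [rewrite mem_index_iota; lia | lia].
Qed.

Lemma uniq_int_range m : uniq (int_range m).
Proof. by rewrite map_inj_uniq ?iota_uniq // => i j; lia. Qed.

(** The coefficient of index [k] of the product of order [m] divided by the middle
    one, [gauss p (m + m) m]; it tends to 1 and is bounded uniformly in [k] and
    [m], which makes dominated convergence applicable. *)
Definition gauss_ratio (m : nat) (k : int) : C :=
  pfact p m * pfact p m / (pfact p `|(m%:Z + k)%R|%N * pfact p `|(m%:Z - k)%R|%N).

Let r := normc p.
Let r0 : 0 <= r. Proof. exact: normc_ge0. Qed.
Let pj_le j : normc (p ^+ j.+1) <= 1 * r ^+ j.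
Proof. by rewrite mul1r normcX exprS ler_piMl ?exprn_ge0 // ltW. Qed.

Let pfact_factor j : 1 - p ^+ j.+1 != 0.
Proof.
rewrite subr_eq0 eq_sym; apply/eqP => /(congr1 (@normc R)); rewrite normc1 normcX => /eqP.
by apply/negP; rewrite lt_eqF // exprn_ilt1.
Qed.

Lemma pfact_neq0 m : pfact p m != 0.
Proof. by apply/prodf_neq0 => j _; exact: pfact_factor. Qed.

Lemma pfact_cvg : exists2 l : C, l != 0 & ccvg \oo (pfact p) l.
Proof.
have [l [pl _]] := infinite_product_cvg r0 p_lt1 pj_le.
exists l => //; exact: (infinite_product_neq0 r0 p_lt1 pj_le _ pl).
Qed.

Lemma gauss_ratioE m k : (`|k| <= m)%N ->
  gauss p (m + m) `|(m%:Z + k)%R|%N = gauss p (m + m) m * gauss_ratio m k.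
Proof.
move=> le_km; rewrite /gauss_ratio.
have e : (m + m - `|(m%:Z + k)%R| = `|(m%:Z - k)%R|)%N by lia.
have e1 : (`|(m%:Z + k)%R| <= m + m)%N by lia.
have := @gauss_pfact _ p _ _ e1; rewrite e => e2.
have := @gauss_pfact _ p (m + m)%N m (leq_addr _ _); rewrite addnK => e3.
by rewrite mulrA e3 -e2 mulfK // mulf_neq0 // pfact_neq0.
Qed.

Lemma theta_prod_ratio z m : z != 0 ->
  theta_prod p z m = gauss p (m + m) m *
    \sum_(k <- int_range m) gauss_ratio m k * jterm z k.
Proof.
move=> z0; rewrite theta_prod_expand // /int_range big_map big_mkord mulr_sumr.
apply: eq_bigr => i _; rewrite [RHS]mulrA -gauss_ratioE; last by have := ltn_ord i; lia.
by congr (gauss _ _ _ * _); lia.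
Qed.

Lemma gauss_ratio_bounded : exists2 D : R, 1 <= D &
  forall m k, normc (gauss_ratio m k) <= D.
Proof.
have [d d0 le_d] := infinite_product_lbound r0 p_lt1 pj_le pfact_factor.
pose B := expR (1 / (1 - r)).
have le_B m : normc (pfact p m) <= B by exact: (tail_product_le r0 p_lt1 pj_le 0).
exists (1 + B * B / (d * d)); first by rewrite lerDl divr_ge0 ?mulr_ge0 ?expR_ge0 // ltW.
move=> m k; apply: (@le_trans _ _ (B * B / (d * d))); last by rewrite lerDr.
rewrite /gauss_ratio normcM normcV !normcM; apply: ler_pM.
- by rewrite mulr_ge0 ?normc_ge0.
- by rewrite invr_ge0 mulr_ge0 ?normc_ge0.
- by apply: ler_pM; rewrite ?normc_ge0.
rewrite lef_pV2 ?posrE ?mulr_gt0 ?normc_gt0 ?pfact_neq0 //.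
by apply: ler_pM; rewrite ?(ltW d0) ?le_d.
Qed.

Lemma ccvg_comp_nat (u : nat -> C) (l : C) (phi : nat -> nat) :
    ccvg \oo u l -> (forall M, exists M', forall m, (M' <= m)%N -> (M <= phi m)%N) ->
  ccvg \oo (fun m => u (phi m)) l.
Proof.
move=> ul phi_oo; apply/ccvgP/cvgrPdist_lt => e e0.
have [M uM] := ccvg_eventually ul e0; have [M' phiM] := phi_oo M.
by exists M' => // m /phiM/uM /=; rewrite sub0r normrN (ger0_norm (normc_ge0 _)).
Qed.

Lemma gauss_ratio_cvg k : ccvg \oo (gauss_ratio ^~ k) 1.
Proof.
have [l l0 pl] := pfact_cvg.
have -> : 1 = l * l / (l * l) by rewrite divff // mulf_neq0.
apply: ccvgM; first exact: (ccvgM pl pl).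
apply: ccvgV; first by rewrite mulf_neq0.
apply: ccvgM; apply: (ccvg_comp_nat (u := pfact p) pl) => M;
  by exists (M + `|k|)%N => m; lia.
Qed.

Lemma normcXz z k : normc (z ^ k) = normc z ^ k.
Proof. by case: k => n; rewrite ?NegzE -?exprnN ?normcV normcX. Qed.

(** The Gaussian decay [|h| ^ (k ^ 2)] beats any geometric growth. *)
Lemma jacobi_term_bound z : z != 0 ->
  exists2 H : R, 0 <= H & forall k, normc (jterm z k) <= H * 2^-1 ^+ `|k|%N.
Proof.
move=> z0; pose rho := normc h; have rho0 : 0 < rho by exact: normc_gt0.
have rho1 : rho < 1.
  by apply: contraTT p_lt1; rewrite -!leNgt -hE normcX; exact: exprn_ege1.
pose t := normc z / rho; have t0 : 0 < t by rewrite divr_gt0 ?normc_gt0.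
pose M := Num.max t t^-1; have M0 : 0 < M by rewrite lt_max t0.
have [N rhoN] : exists N, 2 * M * rho ^+ N <= 1.
  have : (fun m => 2 * M * rho ^+ m) @ \oo --> (0 : R).
    rewrite -[X in _ --> X](mulr0 (2 * M)); apply: cvgM; first exact: cvg_cst.
    by apply: cvg_expr; rewrite ger0_norm // ltW.
  move=> /cvgrPdist_lt/(_ 1 ltr01)[N _ /(_ N (leqnn N))].
  by rewrite /= sub0r normrN => /ltW h1; exists N; apply: le_trans h1; exact: ler_norm.
have M20 : 0 <= 2 * M by rewrite mulr_ge0 // ltW.
exists ((1 + 2 * M) ^+ N) => [|k]; first by rewrite exprn_ge0 // addr_ge0.
set n := `|k|%N.
have -> : normc (jterm z k) = rho ^+ (n * n) * t ^ k.
  have nn : (n * n)%:Z = k * k.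
    by rewrite PoszM /n abszE -normrM ger0_norm // -expr2 sqr_ge0.
  rewrite /jacobi_term normcM !normcXz normcN -/rho exprnP nn /t.
  rewrite expfzMl exprz_inv mulrCA mulrC; congr (_ * _).
  by rewrite -expfzDr // gt_eqF.
have tk : t ^ k <= M ^+ n.
  rewrite /n; case: (k) => i /=; first by rewrite lerXn2r ?nnegrE ?(ltW t0) ?(ltW M0) // le_max lexx.
  rewrite NegzE -exprnN -exprVn lerXn2r ?nnegrE ?invr_ge0 ?(ltW t0) ?(ltW M0) //.
  by rewrite le_max lexx orbT.
apply: (@le_trans _ _ (rho ^+ (n * n) * M ^+ n)).
  by rewrite ler_wpM2l // exprn_ge0 // ltW.
rewrite exprVn ler_pdivlMr ?exprn_gt0 // -mulrA -exprMn mulrC exprM -exprMn.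
rewrite [M * 2]mulrC.
have [le_nN|lt_Nn] := leqP n N.
  apply: (@le_trans _ _ ((1 + 2 * M) ^+ n)).
    rewrite lerXn2r ?nnegrE ?mulr_ge0 ?exprn_ge0 ?addr_ge0 ?(ltW rho0) ?(ltW M0) //.
    apply: (@le_trans _ _ (2 * M)); last by rewrite lerDr.
    by rewrite ler_piMr // exprn_ile1 ?ltW.
  by apply: ler_weXn2l => //; rewrite lerDl.
apply: (@le_trans _ _ 1); last by rewrite exprn_ege1 // lerDl.
rewrite exprn_ile1 ?mulr_ge0 ?exprn_ge0 ?(ltW rho0) ?(ltW M0) //.
apply: le_trans rhoN; rewrite ler_wpM2l //.
by apply: ler_wiXn2l; [exact: ltW | exact: ltW | exact: ltnW].
Qed.

Lemma sum_half_powers m : \sum_(k <- int_range m) (2^-1 : R) ^+ `|k|%N <= 4.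
Proof.
have h20 : (0 : R) <= 2^-1 by lra.
have h21 : (2^-1 : R) < 1 by lra.
have gb (k : nat) : \sum_(j < k) (2^-1 : R) ^+ j <= 2.
  have := @geometric_bound R (2^-1) 1 0 k h20 h21 ler01.
  have -> : \sum_(j < k) 1 * (2^-1 : R) ^+ (0 + j) = \sum_(j < k) (2^-1 : R) ^+ j.
    by apply: eq_bigr => j _; rewrite mul1r.
  move=> /le_trans; apply; rewrite expr0; have -> : 1 - 2^-1 = 2^-1 :> R by lra.
  rewrite invrK; lra.
rewrite /int_range big_map big_mkord -addnS big_split_ord /=.
apply: (@le_trans _ _ (2 + 2)); last by lra.
apply: lerD; last first.
  apply: le_trans (gb m.+1); apply: ler_sum => j _.
  by have -> : `|((m + j)%N%:Z - m%:Z)%R|%N = j by lia.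
apply: le_trans (gb m); rewrite [X in _ <= X](reindex_inj rev_ord_inj) /=.
apply: ler_sum => j _; apply: ler_wiXn2l => //; first exact: ltW.
by have := ltn_ord j; lia.
Qed.

Definition pairs m : seq (int * int) := [seq (k, l) | k <- int_range m, l <- int_range m].

Lemma mem_pairs m (v : int * int) : (v \in pairs m) = (`|v.1| <= m)%N && (`|v.2| <= m)%N.
Proof.
case: v => k l /=; rewrite -!mem_int_range; apply/allpairsP/andP => [[[a b] [/= ia ib [-> ->]]]|[ik il]].
  by [].
by exists (k, l).
Qed.

Lemma uniq_pairs m : uniq (pairs m).
Proof. by apply: allpairs_uniq => [||[? ?] [? ?] _ _ //]; exact: uniq_int_range. Qed.

Lemma sum_pairs (V : comNzRingType) m (f g : int -> V) :
  \sum_(v <- pairs m) f v.1 * g v.2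
  = (\sum_(k <- int_range m) f k) * (\sum_(l <- int_range m) g l).
Proof. by rewrite /pairs big_allpairs_dep /= big_distrlr. Qed.

Lemma sum_half_powers_pairs (s : seq (int * int)) : uniq s ->
  \sum_(v <- s) (2^-1 : R) ^+ `|v.1|%N * 2^-1 ^+ `|v.2|%N <= 16.
Proof.
move=> us; have [m sm] : exists m, {subset s <= pairs m}.
  elim: (s) => [|v s' [m s'm]]; first by exists 0%N.
  exists (m + `|v.1| + `|v.2|)%N => w; rewrite inE mem_pairs => /predU1P[->|/s'm]; first lia.
  by rewrite mem_pairs; lia.
apply: (@le_trans _ _ (\sum_(v <- pairs m) (2^-1 : R) ^+ `|v.1|%N * 2^-1 ^+ `|v.2|%N)).
  rewrite (sum_uniq_subset _ us (uniq_pairs m) sm) lerDl; apply: sumr_ge0 => i _ /=.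
  by rewrite mulr_ge0 ?exprn_ge0 ?invr_ge0.
rewrite (sum_pairs m (fun k => (2^-1 : R) ^+ `|k|%N) (fun k => (2^-1 : R) ^+ `|k|%N)).
have := sum_half_powers m; have : 0 <= \sum_(k <- int_range m) (2^-1 : R) ^+ `|k|%N.
  by apply: sumr_ge0 => i _; rewrite exprn_ge0 ?invr_ge0.
by move: (\sum_(k <- _) _) => S; nra.
Qed.

(** With [odd_pair], the change of indices that separates the pairs [(k, l)] by
    the parity of [k + l] and makes [jacobi_term_pair] a product of a function
    of [x] and a function of [y]. *)
Definition even_pair (v : int * int) : int * int := (v.1 + 1 + v.2, v.1 + 1 - v.2).
Definition odd_pair (v : int * int) : int * int := (v.1 + v.2 + 1, v.1 - v.2).
Definition split_pairs m := map even_pair (pairs m) ++ map odd_pair (pairs m).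

Lemma uniq_split_pairs m : uniq (split_pairs m).
Proof.
rewrite cat_uniq; apply/and3P; split.
- rewrite map_inj_uniq ?uniq_pairs // => -[a b] [a' b'].
  by rewrite /even_pair /= => -[? ?]; congr (_, _); lia.
- apply/hasPn => v /mapP[[a b] _ ->]; apply/negP => /mapP[[a' b'] _ []].
  by rewrite /odd_pair /even_pair /=; lia.
- rewrite map_inj_uniq ?uniq_pairs // => -[a b] [a' b'].
  by rewrite /odd_pair /= => -[? ?]; congr (_, _); lia.
Qed.

Lemma int_half k : exists j, k = 2 * j \/ k = 2 * j + 1.
Proof. by exists (k %/ 2)%Z; lia. Qed.

Lemma mem_split_pairs (v : int * int) : exists M, forall m, (M <= m)%N ->
  (v \in pairs m) && (v \in split_pairs m).
Proof.
case: v => k l; exists (`|k| + `|l| + 2)%N => m le_m; rewrite mem_pairs /=.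
apply/andP; split; first by lia.
have [j [kl|kl]] := int_half (k + l); rewrite mem_cat; apply/orP; [left|right]; apply/mapP.
  by exists (j - 1, k - j); [rewrite mem_pairs /=; lia | rewrite /even_pair /=; congr (_, _); lia].
by exists (j, k - j - 1); [rewrite mem_pairs /=; lia | rewrite /odd_pair /=; congr (_, _); lia].
Qed.

(** A partial sum of a theta function of base [p ^ 2]; so is [theta_odd]. *)
Definition theta_even (m : nat) (z : C) : C := \sum_(k <- int_range m) h ^ (2 * k * k) * z ^ (2 * k).
Definition theta_odd (m : nat) (z : C) : C :=
  \sum_(k <- int_range m) h ^ (2 * k * k + 2 * k) * z ^ (2 * k + 1).

(** The shift by 1 in [even_pair] aligns the ranges, so that the partial sum is
    exactly a determinant and not only in the limit. *)
Lemma sum_split_pairs m x y : x != 0 -> y != 0 ->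
  \sum_(v <- split_pairs m) jterm (x * y) v.1 * jterm (x / y) v.2
  = x * (theta_odd m x * theta_even m y - theta_even m x * theta_odd m y).
Proof.
move=> x0 y0; have m1 : (-1 : C) != 0 by rewrite oppr_eq0 oner_eq0.
have sgn_even k : (-1 : C) ^ (2 * k) = 1.
  by rewrite -exprz_exp -exprnP sqrrN expr1n exp1rz.
rewrite big_cat !big_map /= mulrBr; congr (_ + _).
  rewrite /theta_odd /theta_even -(sum_pairs m (fun k => h ^ (2 * k * k + 2 * k) * x ^ (2 * k + 1))
    (fun k => h ^ (2 * k * k) * y ^ (2 * k))) mulr_sumr.
  apply: eq_bigr => -[k l] _; rewrite /even_pair /= (jacobi_term_pair p0 hE) //.
  have -> : k + 1 + l + (k + 1 - l) = 2 * k + 1 + 1 by lia.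
  have -> : k + 1 + l - (k + 1 - l) = 2 * l by lia.
  have -> : (k + 1 + l) * (k + 1 + l) - (k + 1 + l) +
      ((k + 1 - l) * (k + 1 - l) - (k + 1 - l)) = 2 * k * k + 2 * k + 2 * l * l by lia.
  have -> : (-1 : C) ^ (2 * k + 1 + 1) = 1.
    by have -> : 2 * k + 1 + 1 = 2 * (k + 1) by lia.
  rewrite !(@expfzDr C x) // !expr1z (@expfzDr C h _ (2 * l * l)) //.
  by ring.
rewrite /theta_odd /theta_even -(sum_pairs m (fun k => h ^ (2 * k * k) * x ^ (2 * k))
    (fun k => h ^ (2 * k * k + 2 * k) * y ^ (2 * k + 1))) mulr_sumr -sumrN.
apply: eq_bigr => -[k l] _; rewrite /odd_pair /= (jacobi_term_pair p0 hE) //.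
have -> : k + l + 1 + (k - l) = 2 * k + 1 by lia.
have -> : k + l + 1 - (k - l) = 2 * l + 1 by lia.
have -> : (k + l + 1) * (k + l + 1) - (k + l + 1) +
      ((k - l) * (k - l) - (k - l)) = 2 * k * k + (2 * l * l + 2 * l) by lia.
have -> : (-1 : C) ^ (2 * k + 1) = -1 by rewrite expfzDr // sgn_even mul1r expr1z.
rewrite !(@expfzDr C x) // !expr1z [h ^ (2 * k * k + _)]expfzDr //.
by ring.
Qed.

Lemma gauss_neq0 m : gauss p (m + m) m != 0.
Proof.
have := @gauss_pfact _ p (m + m)%N m (leq_addr _ _).
by apply: contra_eq_neq => ->; rewrite mul0r eq_sym pfact_neq0.
Qed.

Definition theta_wedge (m : nat) (x y : C) : C :=
  theta_odd m x * theta_even m y - theta_even m x * theta_odd m y.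

(** Both terms are partial sums of the same absolutely convergent double series,
    over two different exhaustions of [Z ^ 2]. *)
Lemma theta_pair_cvg x y : x != 0 -> y != 0 ->
  ccvg \oo (fun m => theta_prod p (x * y) m * theta_prod p (x / y) m / gauss p (m + m) m ^+ 2
                     - x * theta_wedge m x y) 0.
Proof.
move=> x0 y0; have xy0 : x * y != 0 by rewrite mulf_neq0.
have xVy0 : x / y != 0 by rewrite mulf_neq0 ?invr_eq0.
have [D D1 le_D] := gauss_ratio_bounded.
have [H H0 le_H] := jacobi_term_bound xy0; have [H' H'0 le_H'] := jacobi_term_bound xVy0.
have D0 : 0 <= D by exact: le_trans D1.
pose W (v : int * int) := (D * D * H * H') * (2^-1 ^+ `|v.1|%N * 2^-1 ^+ `|v.2|%N).
pose g (v : int * int) := jterm (x * y) v.1 * jterm (x / y) v.2.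
pose f m (v : int * int) := gauss_ratio m v.1 * gauss_ratio m v.2 * g v.
have gW v : normc (g v) <= (H * H') * (2^-1 ^+ `|v.1|%N * 2^-1 ^+ `|v.2|%N).
  by rewrite normcM mulrACA; apply: ler_pM; rewrite ?normc_ge0.
have e0 v : 0 <= (2^-1 : R) ^+ `|(v : int * int).1|%N * 2^-1 ^+ `|v.2|%N.
  by rewrite mulr_ge0 ?exprn_ge0 ?invr_ge0.
have := @tannery R _ W (D * D * H * H' * 16) pairs split_pairs f g.
move=> /(_ _ _ uniq_pairs uniq_split_pairs mem_split_pairs) tan.
have {tan} : ccvg \oo (fun m => \sum_(i <- pairs m) f m i - \sum_(i <- split_pairs m) g i) 0.
  apply: tan.
  - by move=> v; rewrite mulr_ge0 // !mulr_ge0.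
  - move=> s us; rewrite -mulr_sumr ler_wpM2l ?mulr_ge0 //.
    exact: sum_half_powers_pairs.
  - move=> m v; rewrite /f normcM normcM /W -[D * D * H * H']mulrA -[_ * _ * (2^-1 ^+ _ * _)]mulrA.
    by apply: ler_pM; rewrite ?mulr_ge0 ?normc_ge0 //; apply: ler_pM; rewrite ?normc_ge0.
  - move=> v; apply: le_trans (gW v) _; rewrite /W ler_wpM2r // -mulrA ler_peMl ?mulr_ge0 //.
    by rewrite -[1]mulr1 ler_pM.
  move=> v; rewrite -[g v]mul1r -{1}[1 : C]mulr1.
  exact: (ccvgM (ccvgM (gauss_ratio_cvg _) (gauss_ratio_cvg _)) (ccvg_cst _)).
congr (ccvg _ _ _); apply/funext => m; congr (_ - _); last by rewrite /g sum_split_pairs.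
rewrite !theta_prod_ratio // /f /g.
have -> : \sum_(v <- pairs m) gauss_ratio m v.1 * gauss_ratio m v.2
      * (jterm (x * y) v.1 * jterm (x / y) v.2)
  = (\sum_(k <- int_range m) gauss_ratio m k * jterm (x * y) k)
    * (\sum_(k <- int_range m) gauss_ratio m k * jterm (x / y) k).
  rewrite -(sum_pairs m (fun k => gauss_ratio m k * jterm (x * y) k)
     (fun k => gauss_ratio m k * jterm (x / y) k)).
  by apply: eq_bigr => v _; rewrite mulrACA.
exact: (esym (cancel_common_factor _ _ (gauss_neq0 m))).
Qed.

Lemma gauss_middle_cvg : exists2 l : C, l != 0 & ccvg \oo (fun m => gauss p (m + m) m ^+ 2) l.
Proof.
have [l l0 pl] := pfact_cvg.
have ll0 : l * l != 0 by rewrite mulf_neq0.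
exists ((l / (l * l)) ^+ 2); first by rewrite expf_neq0 // mulf_neq0 ?invr_eq0.
have gc : ccvg \oo (fun m => gauss p (m + m) m) (l / (l * l)).
  have -> : (fun m => gauss p (m + m) m) = (fun m => pfact p (m + m) / (pfact p m * pfact p m)).
    apply/funext => m; have := @gauss_pfact _ p (m + m)%N m (leq_addr _ _).
    by rewrite addnK => <-; rewrite mulfK // mulf_neq0 // pfact_neq0.
  apply: ccvgM; last exact: (ccvgV ll0 (ccvgM pl pl)).
  by apply: (ccvg_comp_nat (u := pfact p) pl) => M; exists M => m; lia.
exact: (ccvgM gc gc).
Qed.

Lemma theta_wedge_cvg : exists2 P : C, P != 0 & forall x y, x != 0 -> y != 0 ->
  ccvg \oo (fun m => theta_wedge m x y) (P * thpair (theta p) x y).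
Proof.
have [l l0 gl] := gauss_middle_cvg; exists l^-1; first by rewrite invr_eq0.
move=> x y x0 y0; have xy0 : x * y != 0 by rewrite mulf_neq0.
have xVy0 : x / y != 0 by rewrite mulf_neq0 ?invr_eq0.
have c1 : ccvg \oo (fun m => theta_prod p (x * y) m * theta_prod p (x / y) m
    / gauss p (m + m) m ^+ 2) (theta p (x * y) * theta p (x / y) / l).
  exact: (ccvgM (ccvgM (theta_cvg p_lt1 xy0) (theta_cvg p_lt1 xVy0)) (ccvgV l0 gl)).
have -> : l^-1 * thpair (theta p) x y = (theta p (x * y) * theta p (x / y) / l - 0) / x.
  by rewrite /thpair; field; rewrite l0 x0.
have -> : (fun m => theta_wedge m x y) = (fun m => (theta_prod p (x * y) m * theta_prod p (x / y) m
    / gauss p (m + m) m ^+ 2 - (theta_prod p (x * y) m * theta_prod p (x / y) m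
    / gauss p (m + m) m ^+ 2 - x * theta_wedge m x y)) / x).
  by apply/funext => m; field; rewrite x0 gauss_neq0.
exact: (ccvgM (ccvgB c1 (theta_pair_cvg x0 y0)) (ccvg_cst x^-1)).
Qed.

Lemma theta_plucker x y u v : x != 0 -> y != 0 -> u != 0 -> v != 0 ->
  let E := thpair (theta p) in
  E x y * E u v - E x u * E y v + E x v * E y u = 0.
Proof.
move=> x0 y0 u0 v0 E; have [P P0 wE] := theta_wedge_cvg.
pose w := theta_wedge.
have : ccvg \oo (fun m => w m x y * w m u v - w m x u * w m y v + w m x v * w m y u)
   (P * E x y * (P * E u v) - P * E x u * (P * E y v) + P * E x v * (P * E y u)).
  exact: (ccvgD (ccvgB (ccvgM (wE x y x0 y0) (wE u v u0 v0))
    (ccvgM (wE x u x0 u0) (wE y v y0 v0))) (ccvgM (wE x v x0 v0) (wE y u y0 u0))).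
have -> : (fun m => w m x y * w m u v - w m x u * w m y v + w m x v * w m y u) = (fun=> 0).
  by apply/funext => m; exact: wedge_plucker.
move=> c0; have e := ccvg_unique _ c0 (ccvg_cst 0).
apply: (mulfI (expf_neq0 2 P0)); rewrite mulr0 -[RHS]e; ring.
Qed.
End ThetaSeries.

Section ThetaIsThetaLike.
Variables (R : realType) (p : R[i]).
Hypothesis p_lt1 : normc p < 1.
Local Notation C := R[i].

(** The base [p = 0] is treated apart, since the expansion above uses negative
    powers of [p]. *)
Lemma theta_base0 (z : C) : z != 0 -> theta 0 z = 1 - z.
Proof.
move=> z0; have lt01 : normc (0 : C) < 1 by rewrite normc0.
apply: (ccvg_unique _ (theta_cvg lt01 z0)).
apply/ccvgP; apply: cvg_near_cst; exists 1%N => // m /= m1.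
case: m m1 => // m _; rewrite /theta_prod big_ord_recl expr0 expr1 mul0r subr0 !mulr1.
rewrite big1 ?mulr1 ?subrr ?normc0 // => j _.
by rewrite !expr0n /= mulr0 mul0r subr0 mulr1.
Qed.

Lemma theta_like_theta : theta_like (theta p).
Proof.
split; [exact: theta1 | by move=> x; exact: thetaV|].
move=> x y u v x0 y0 u0 v0; have [p0|p0] := eqVneq p 0; last first.
  exact: (@theta_plucker _ p (sqrtc p) p0 (sqr_sqrtc p) p_lt1 x y u v).
have mulC_neq0 (s t : C) : s != 0 -> t != 0 -> s * t != 0 by move=> *; rewrite mulf_neq0.
have divC_neq0 (s t : C) : s != 0 -> t != 0 -> s / t != 0.
  by move=> *; rewrite mulf_neq0 ?invr_eq0.
rewrite p0 /thpair !theta_base0; try by [exact: mulC_neq0 | exact: divC_neq0].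
by field; rewrite x0 y0 u0 v0.
Qed.

(** * Removal of the genericity assumptions *)

(** The zeros of [c |-> theta p (u i / c)] are countably many, while a segment
    starting at [c0] is uncountable, so [c0] is a limit of points where no
    [theta p (u i / c)] vanishes. *)
Lemma theta_generic_point (I : countType) (u : I -> C) (c0 : C) (G : C -> C) :
    c0 != 0 -> (forall i, u i != 0) -> ccvg (nbhs (c0 : R[i]^o)) G (G c0) ->
    (forall c, c != 0 -> (forall i, theta p (u i / c) != 0) -> G c = 0) ->
  G c0 = 0.
Proof.
move=> c00 u0 Gc G0; apply/eqP/negPn/negP => Gc0.
have n0 := normc_gt0 c00; have g0 := normc_gt0 Gc0.
have /ccvgP/cvgrPdist_lt/(_ _ g0) nearG := Gc.
have [d d0 ballG] : exists2 d : R, 0 < d & forall c, normc (c - c0) < d -> G c != 0.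
  have [e /= e0 eG] := nearG.
  have eE : (complex.Re e)%:C = e by apply: RRe_real; exact: gtr0_real.
  exists (complex.Re e) => [|c lt_c]; first by rewrite -ltcR eE.
  have : normc (G c - G c0) < normc (G c0).
    have := eG c; rewrite /= sub0r normrN (ger0_norm (normc_ge0 _)); apply.
    by rewrite /= -eE normc_distC in lt_c *; rewrite ltcR.
  by apply: contraTneq => ->; rewrite sub0r normcN ltxx.
pose bad (v : I * nat * bool) : R := complex.Re
  (if v.2 then u v.1.1 * p ^+ v.1.2 / c0 else u v.1.1 / p ^+ v.1.2.+1 / c0) - 1.
pose e := d / normc c0; have e0 : 0 < e by rewrite divr_gt0.
have bad_count : countable (range bad).
  by apply: sub_countable (card_image_le _ _) _; exact: countableP.
have [s /= s0e s_good] : exists2 s : R, `]0, e[%classic s & ~ range bad s.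
  apply: contrapT => /forall2NP all_bad.
  have sub : `]0, e[%classic `<=` range bad.
    by move=> s se; have [//|/contrapT] := all_bad s.
  have := countable_lebesgue_measure0 (sub_countable (subset_card_le sub) bad_count).
  rewrite lebesgue_measure_itv /= lte_fin e0 sube0 => /eqP.
  by rewrite eqe gt_eqF.
move: s0e; rewrite in_itv /= => /andP[s0 se].
pose c := c0 * (1 + s%:C).
have s1 : 1 + s%:C != 0 :> C.
  by rewrite -(rmorph1 (real_complex R)) -rmorphD /= eq_complex /= eqxx andbT gt_eqF // addr_gt0.
have cn0 : c != 0 by rewrite mulf_neq0.
have : G c != 0.
  apply: ballG; have -> : c - c0 = c0 * s%:C by rewrite /c; ring.
  have -> : normc (c0 * s%:C) = normc c0 * s.
    by rewrite normcM; congr (_ * _); rewrite /= expr0n addr0 sqrtr_sqr ger0_norm // ltW.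
  by move: se; rewrite /e ltr_pdivlMr // mulrC.
rewrite G0 ?eqxx // => i; apply/negP => /eqP thi; apply: s_good.
have sE w : c = w -> s = complex.Re (w / c0) - 1.
  move=> <-; have -> : c / c0 = 1 + s%:C by rewrite /c; field.
  by rewrite raddfD /= addrAC subrr add0r.
have [|j [e1|e1]] := theta_eq0 p_lt1 _ thi; first by rewrite mulf_neq0 ?invr_eq0.
  exists (i, j, true) => //; rewrite /bad /= -sE //.
  by rewrite -[LHS]mul1r -e1; field.
exists (i, j, false) => //; rewrite /bad /= -sE // e1; field.
by rewrite cn0 u0.
Qed.

Lemma theta_ccvg (T : Type) (F : set_system T) {FF : Filter F} (f : T -> C) (l : C) :
  l != 0 -> ccvg F f l -> ccvg F (fun t => theta p (f t)) (theta p l).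
Proof.
move=> l0 fl; have tc := @theta_continuous R p p_lt1 l l0.
rewrite /ccvg in fl tc *; apply: cvg_comp fl _; exact: tc.
Qed.
End ThetaIsThetaLike.

Arguments theta_ccvg {R p} p_lt1 {T F FF f l} _ _.

Section SubsetSumTheta.
Variables (R : realType) (p : R[i]).
Hypothesis p_lt1 : normc p < 1.
Local Notation C := R[i].
Variables (T : finType) (x : T -> C) (q a w : C).
Hypotheses (q0 : q != 0) (a0 : a != 0) (w0 : w != 0).
Hypothesis x0 : forall r, x r != 0.

Lemma subset_term_ccvg (e c d : C) (A I : {set T}) : e != 0 -> c != 0 -> d != 0 ->
  ccvg (nbhs (c : R[i]^o)) (fun z => subset_term (theta p) x q a (e / z) w z d A I)
       (subset_term (theta p) x q a (e / c) w c d A I).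
Proof.
move=> e0 c0 d0.
have idc : ccvg (nbhs (c : R[i]^o)) (fun z => z) c by exact: cvg_id.
have divc (s : C) : ccvg (nbhs (c : R[i]^o)) (fun z => s / z) (s / c).
  exact: (ccvgM (ccvg_cst s) (ccvgV c0 idc)).
have mulc (s : C) : ccvg (nbhs (c : R[i]^o)) (fun z => z * s) (c * s).
  exact: (ccvgM idc (ccvg_cst s)).
have divMc (s t : C) : ccvg (nbhs (c : R[i]^o)) (fun z => s / z * t) (s / c * t).
  exact: (@ccvgM R _ _ _ (fun z => s / z) (fun=> t) (s / c) t (divc s) (ccvg_cst t)).
have divn0 (s : C) : s != 0 -> s / c != 0 by move=> s0; rewrite mulf_neq0 ?invr_eq0.
have muln0 (s t : C) : s != 0 -> t != 0 -> s * t != 0 by move=> *; rewrite mulf_neq0.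
rewrite /subset_term.
apply: ccvgM; last exact: ccvg_cst.
apply: ccvgM; last first.
  apply: ccvg_prod => r _; apply: ccvgM; last exact: ccvg_cst.
  by apply: ccvgM (ccvg_cst _); apply: theta_ccvg (mulc _) => //; exact: muln0.
apply: ccvgM; last first.
  apply: ccvg_prod => r _; apply: ccvgM (ccvg_cst _); apply: ccvgM (ccvg_cst _).
  apply: (@theta_ccvg R p p_lt1 _ _ _ (fun z => e / z / (q * a * x r)) _ _ (divMc _ _)).
  by rewrite muln0 ?divn0 // invr_eq0 !muln0.
apply: ccvgM; last first.
  apply: ccvg_prod => j _; apply: ccvgM (ccvg_cst _); apply: theta_ccvg (divc _) => //.
  by rewrite divn0 // mulf_neq0 ?expf_neq0.
apply: ccvgM (ccvg_cst _); apply: ccvgM; last first.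
  have -> : (fun z => (w / (z * d)) ^+ #|I|) = (fun z => \prod_(i < #|I|) (w / d / z)).
    by apply/funext => z; rewrite prodr_const card_ord; congr (_ ^+ _); rewrite invfM mulrA mulrAC.
  have -> : (w / (c * d)) ^+ #|I| = \prod_(i < #|I|) (w / d / c).
    by rewrite prodr_const card_ord; congr (_ ^+ _); rewrite invfM mulrA mulrAC.
  by apply: ccvg_prod => j _; exact: divc.
apply: ccvgM (ccvg_cst _); apply: ccvg_prod => j _.
apply: (@theta_ccvg R p p_lt1 _ _ _ (fun z => e / z * q ^+ j) _ _ (divMc _ _)).
by rewrite muln0 ?divn0 // expf_neq0.
Qed.

Lemma subset_value_ccvg (c d : C) (A : {set T}) : c != 0 -> d != 0 ->
  ccvg (nbhs (c : R[i]^o)) (fun z => subset_value (theta p) x q a w z d A)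
       (subset_value (theta p) x q a w c d A).
Proof.
move=> c0 d0.
have idc : ccvg (nbhs (c : R[i]^o)) (fun z => z) c by exact: cvg_id.
have divc (s : C) : ccvg (nbhs (c : R[i]^o)) (fun z => s / z) (s / c).
  exact: (ccvgM (ccvg_cst s) (ccvgV c0 idc)).
have divn0 (s : C) : s != 0 -> s / c != 0 by move=> s0; rewrite mulf_neq0 ?invr_eq0.
rewrite /subset_value; apply: ccvgM; apply: ccvg_prod => j _.
  apply: ccvgM (ccvg_cst _); apply: theta_ccvg (divc _) => //.
  by rewrite divn0 // mulf_neq0 ?expf_neq0.
have E z : a * q ^+ #|A| / (z * d * x j) = a * q ^+ #|A| / (d * x j) / z.
  by rewrite -[RHS]mulrA -invfM; congr (_ / _); ring.
rewrite E; under eq_fun do rewrite E.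
apply: (@theta_ccvg R p p_lt1 _ _ _ (fun z => a * q ^+ #|A| / (d * x j) / z) _ _ (divc _)).
by rewrite divn0 // mulf_neq0 ?invr_eq0 ?mulf_neq0 ?expf_neq0.
Qed.

(** The genericity assumptions of [subset_sum_generic] are removed by moving [c]
    while [d] and [w] stay put and [f] follows the balancing condition. *)
Lemma subset_sum (A : {set T}) (c d f : C) :
    f != 0 -> c != 0 -> d != 0 -> a * w * q ^+ #|A| = f * c * d ->
    (forall r k, r \in A -> (k <= #|A|)%N -> theta p (a * x r * q ^+ k) != 0) ->
    (forall r s, r \in A -> s \in A -> r != s -> theta p (x r / x s) != 0) ->
  \sum_(I : {set T} | I \subset A) subset_term (theta p) x q a f w c d A I
  = subset_value (theta p) x q a w c d A.
Proof.
move=> f0 c0 d0 bal axA xxA.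
pose e := f * c; have e0 : e != 0 by rewrite mulf_neq0.
pose G z := \sum_(I : {set T} | I \subset A) subset_term (theta p) x q a (e / z) w z d A I
  - subset_value (theta p) x q a w z d A.
suff : G c = 0.
  by rewrite /G /e mulfK // => /eqP; rewrite subr_eq0 => /eqP.
pose u (i : T * T * nat + T) := match i with
  | inl (r, s, k) => q ^+ k / (d * x r * x s)
  | inr r => a * q ^+ #|A| / (d * x r) end.
apply: (@theta_generic_point R p p_lt1 _ u) => //.
- case=> [[[r s] k]|r] /=.
    by rewrite mulf_neq0 ?invr_eq0 ?expf_neq0 ?mulf_neq0.
  by rewrite mulf_neq0 ?invr_eq0 ?mulf_neq0 ?expf_neq0.
- apply: ccvgB; last exact: subset_value_ccvg.
  by apply: ccvg_sum => I _; exact: subset_term_ccvg.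
move=> z z0 thu; apply/eqP; rewrite subr_eq0; apply/eqP.
apply: subset_sum_generic => //.
- exact: theta_like_theta.
- by move=> t; exists (sqrtc t); exact: sqr_sqrtc.
- by rewrite bal /e; field.
- move=> r s k _ _ _; have := thu (inl (r, s, k)); rewrite /u -mulrA -invfM.
  by have -> : d * x r * x s * z = z * d * x r * x s by ring.
- move=> r _; have := thu (inr r); rewrite /u -mulrA -invfM.
  by have -> : d * x r * z = z * d * x r by ring.
Qed.
End SubsetSumTheta.

(** * The WP Bailey pair *)

(* Subsets and full sets are those of finite types again. *)
Local Close Scope classical_set_scope.

Lemma qpfact_nat (R : realType) (q p z : R[i]) (k : nat) :
  qpfact q p z k = thfact (theta p) z q k.
Proof. by []. Qed.

Lemma qpfacts2 (R : realType) (q p u v : R[i]) (k : nat) :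
  qpfacts q p [:: u; v] k = thfact (theta p) u q k * thfact (theta p) v q k.
Proof. by rewrite /qpfacts 2!big_cons big_nil mulr1. Qed.

Lemma qpfacts3 (R : realType) (q p u v t : R[i]) (k : nat) : qpfacts q p [:: u; v; t] k =
  thfact (theta p) u q k * thfact (theta p) v q k * thfact (theta p) t q k.
Proof. by rewrite /qpfacts 3!big_cons big_nil mulr1 mulrA. Qed.

Lemma B2E (R : realType) (n : nat) (q p a b : R[i]) (x : 'I_n -> R[i]) (k j : 'I_n -> nat) :
    (forall r, (j r <= k r)%N) ->
  B2 q p x a b k j =
  (thfact (theta p) b q (weight k + weight j)
   * \prod_(r < n) thfact (theta p) (b * q ^ ((weight k)%:Z - (k r)%:Z) / (a * x r)) q (k r - j r))
  / ((\prod_(r < n) \prod_(s < n)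
        thfact (theta p) (q ^ (1 + (j r)%:Z - (j s)%:Z) * x r / x s) q (k r - j r))
     * \prod_(r < n) thfact (theta p) (a * x r * q) q (k r + weight j)).
Proof.
move=> le_jk; have kj r : (k r)%:Z - (j r)%:Z = (k r - j r)%N by rewrite subzn.
rewrite /B2; under eq_bigr do rewrite kj.
by under [X in _ / (X * _)]eq_bigr => r _ do under eq_bigr do rewrite kj.
Qed.

Lemma alpha2E (R : realType) (n : nat) (q p a b c d : R[i]) (x : 'I_n -> R[i]) (k : 'I_n -> nat) :
  alpha2 q p x c d a b k =
  \prod_(r < n) (theta p (a * x r * q ^+ (k r + weight k)) / theta p (a * x r)
     * (thfact (theta p) (a * x r) q (weight k)
        * (thfact (theta p) (c * x r) q (k r) * thfact (theta p) (d * x r) q (k r))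
        / thfact (theta p) (b * c * d * x r / a) q (k r)))
  * (thfact (theta p) (a ^+ 2 * q / (b * c * d)) q (weight k)
     / (thfact (theta p) (a * q / c) q (weight k) * thfact (theta p) (a * q / d) q (weight k)
        * \prod_(r < n) \prod_(s < n) thfact (theta p) (q * x r / x s) q (k r)))
  * (b / a) ^+ weight k
  * q ^+ (\sum_(r < n) \sum_(s < n | (r < s)%N) k r * k s)
  * \prod_(r < n) x r ^- k r.
Proof. by rewrite /alpha2 qpfacts2; under eq_bigr do rewrite qpfacts2. Qed.

Lemma int_difference (z : int) : exists i j : nat, z = 1 + i%:Z - j%:Z.
Proof. by case: z => m; [exists m, 1%N | exists 0%N, m.+2]; lia. Qed.

Lemma thfact_neq0 (F : fieldType) (th : F -> F) (q z : F) :
  (forall m, thfact th z q m != 0) -> forall i, th (z * q ^+ i) != 0.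
Proof.
move=> z0 i; have := z0 i.+1; rewrite /thfact big_ord_recr /= mulf_eq0 negb_or.
by case/andP.
Qed.

Theorem theorem4p9 (R : realType) (n : nat) (q p a b c d : R[i])
    (x : 'I_n -> R[i])
    (n_ge1 : (1 <= n)%N)
    (q_neq0 : q != 0) (p_lt1 : `|p| < 1)
    (a_neq0 : a != 0) (b_neq0 : b != 0) (c_neq0 : c != 0) (d_neq0 : d != 0)
    (x_neq0 : forall r : 'I_n, x r != 0)
    (* the denominators of alpha and beta do not vanish *)
    (theta_ax_neq0 : forall r : 'I_n, theta p (a * x r) != 0)
    (bcdx_neq0 : forall (r : 'I_n) (m : nat),
       qpfact q p (b * c * d * x r / a) m != 0)
    (aqc_neq0 : forall m : nat, qpfact q p (a * q / c) m != 0)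
    (aqd_neq0 : forall m : nat, qpfact q p (a * q / d) m != 0)
    (qxx_neq0 : forall (r s : 'I_n) (m : nat),
       qpfact q p (q * x r / x s) m != 0)
    (* the denominators of the entries of B occurring in the sums do not vanish *)
    (Bxx_neq0 : forall (k j : 'I_n -> nat), (forall r : 'I_n, (j r <= k r)%N) ->
       forall r s : 'I_n,
         qpfact q p (q ^ (1 + (j r)%:Z - (j s)%:Z) * x r / x s)
           ((k r)%:Z - (j r)%:Z) != 0)
    (Bax_neq0 : forall (r : 'I_n) (m : nat), qpfact q p (a * x r * q) m != 0) :
  WP_Bailey_pair (B2 q p x) (alpha2 q p x c d) (beta2 q p x c d) a b.
Proof.
move=> N.
have normp : Normc.normc p < 1 by rewrite -ltcR.
set w := b * c * d / a.
have w0 : w != 0 by rewrite !mulf_neq0 ?invr_eq0.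
have thax r i : theta p (a * x r * q ^+ i) != 0.
  case: i => [|i]; first by rewrite expr0 mulr1.
  by rewrite exprS mulrA; apply: thfact_neq0 => m; exact: Bax_neq0.
have thxx r s (z : int) : (r != s) || (0 < z) -> theta p (q ^ z * (x r / x s)) != 0.
  have [<- /=|rs _] := eqVneq r s.
    case: z => // -[//|m] _.
    have -> : q ^ m.+1%:Z * (x r / x r) = q * x r / x r * q ^+ m.
      by rewrite -exprnP exprS; field.
    by apply: thfact_neq0 => i; exact: qxx_neq0.
  have [jr [js jz]] : exists jr js : nat, z = 1 + jr%:Z - js%:Z.
    exact: int_difference.
  pose j t := if t == r then jr else if t == s then js else 0%N.
  have := Bxx_neq0 (fun t => (j t).+1) j (fun t => leqnSn _) r s.
  rewrite /j eqxx [s == r]eq_sym (negbTE rs) eqxx -jz.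
  have -> : jr.+1%:Z - jr%:Z = 1%:Z by rewrite subzn // subSnn.
  by rewrite qpfact_nat /thfact big_ord_recl big_ord0 expr0 !mulr1 mulrA.
pose y := @block_point _ q n N x.
have y0 t : y t != 0 by rewrite mulf_neq0 ?expf_neq0.
pose m := (\sum_(r < n) N r)%N.
have f0 : b * q ^+ m != 0 by rewrite mulf_neq0 ?expf_neq0.
have bal : a * w * q ^+ #|[set: {r : 'I_n & 'I_(N r)}]| = b * q ^+ m * c * d.
  by rewrite card_blocks -/m /w; field.
have main := @subset_sum R p normp _ y q a w q_neq0 a_neq0 w0 y0 [set: _] c d _ f0 c_neq0 d_neq0 bal.
transitivity (block_weight (theta p) q N x a b c d * subset_value (theta p) y q a w c d [set: _]).
  rewrite (@block_value _ (theta p) q q_neq0 n N x a b c d a_neq0 c_neq0 d_neq0 x_neq0 bcdx_neq0).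
  by rewrite /beta2 qpfacts3 qpfacts2.
rewrite -main; last 2 first.
- by move=> t k _ _; rewrite /y /block_point mulrA -mulrA -exprD thax.
- move=> [r i] [s i'] _ _ ne.
  have -> : y (existT _ r i) / y (existT _ s i') = q ^ (i%:Z - i'%:Z) * (x r / x s).
    rewrite /y /block_point /= expfzDr // -exprnN -exprnP; field.
    by rewrite x_neq0 expf_neq0.
  have [rs|rs] := eqVneq r s; last by apply: thxx; rewrite rs.
  rewrite -rs in i' ne *; have [lt_ii'|lt_i'i|eq_ii'] := ltngtP i i'.
  - have pos : (r != r) || (0 < i'%:Z - i%:Z) by rewrite eqxx /= subr_gt0 ltz_nat.
    have := thxx r r _ pos; rewrite divff // !mulr1.
    rewrite -[i%:Z - i'%:Z]opprB.
    rewrite -invr_expz; move: (i'%:Z - i%:Z) => z thz.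
    have qz0 : q ^ z != 0 by exact: expfz_neq0.
    have qz1 : - (q ^ z)^-1 != 0 by rewrite oppr_eq0 invr_eq0.
    by rewrite (thetaV normp qz0); exact: (mulf_neq0 qz1 thz).
  - have pos : (r != r) || (0 < i%:Z - i'%:Z) by rewrite eqxx /= subr_gt0 ltz_nat.
    exact: (thxx r r _ pos).
  by move: ne; rewrite (val_inj eq_ii') eqxx.
transitivity (block_weight (theta p) q N x a b c d *
   \sum_(I : {set {r : 'I_n & 'I_(N r)}}) subset_term (theta p) y q a (b * q ^+ m) w c d [set: _] I).
  by congr (_ * _); apply: eq_bigl => I; rewrite finset.subsetT.
rewrite sum_lower_closed => [|I lowI]; last first.
  by apply: block_term_eq0 => //; exact: theta1.
rewrite mulr_sumr; apply: eq_bigr => j _.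
rewrite (@block_term _ (theta p) q q_neq0 n N x a b c d a_neq0 b_neq0 c_neq0 d_neq0 x_neq0 j thxx thax bcdx_neq0 aqc_neq0 aqd_neq0).
by rewrite B2E ?alpha2E // => r; rewrite -ltnS ltn_ord.
Qed.
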